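(* Let $G$ be a countable, discrete, sofic group with sofic approximation $\sigma_k\colon G\to S_{d_k}$. Let $G\curvearrowright X$, $G\curvearrowright Y$ be two algebraic actions, and suppose that $G\curvearrowright (X,m_X)$ and $G\curvearrowright (Y,m_Y)$ are ergodic. If $Y$ is a topological $G$-factor of $X$ (i.e. there is a continuous, $G$-equivariant, surjective map $X\to Y$, not assumed to be a group homomorphism), and $G\curvearrowright (X,m_X)$ is strongly sofic with respect to $(\sigma_k)_k$, then $G\curvearrowright (Y,m_Y)$ is strongly sofic with respect to $(\sigma_k)_k$.
   Context: $S_n$ is the symmetric group on $\{1,\dots,n\}$, $u_n$ is the uniform probability measure on $\{1,\dots,n\}$, $d_{\mathrm{Hamm}}(p,q)=u_n(\{j:p(j)\ne q(j)\})$. A sofic approximation of a countable discrete group $G$ is a sequence of maps $\sigma_k\colon G\to S_{d_k}$ (not necessarily homomorphisms) with $d_k\to\infty$, $d_{\mathrm{Hamm}}(\sigma_k(gh),\sigma_k(g)\sigma_k(h))\to 0$ for all $g,h\in G$ and $d_{\mathrm{Hamm}}(\sigma_k(g),\sigma_k(h))\to 1$ for all $g\neq h$; $G$ is sofic if it has one. An algebraic action is an action by continuous automorphisms of a compact metrizable group $X$; $m_X$ is the Haar probability measure. Strong soficity. Let $G\curvearrowright X$ by homeomorphisms, $X$ compact metrizable, and let $\mu$ be a $G$-invariant Borel probability measure. Identify $X^{d}$ with maps $\{1,\dots,d\}\to X$; for $\nu\in\mathrm{Prob}(X^d)$ let $\nu_j\in\mathrm{Prob}(X)$ be the $j$-th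 marginal. $G\curvearrowright(X,\mu)$ is strongly sofic with respect to $(\sigma_k)_k$ if there are $\mu_k\in\mathrm{Prob}(X^{d_k})$ such that: (1) for every weak$^*$ neighborhood $\mathcal O$ of $\mu$, $u_{d_k}(\{j:\mu_{k,j}\in\mathcal O\})\to1$; (2) for every $g\in G$, $\delta>0$ and every neighborhood $U$ of the diagonal in $X\times X$, $\mu_k(\{\phi:u_{d_k}(\{j:(\phi(\sigma_k(g)(j)),g\phi(j))\in U\})\ge 1-\delta\})\to 1$; (3) for all $f\in C(X\times X)$, $\varepsilon>0$, $(\mu_k\otimes\mu_k)(\{(\phi,\psi):|\frac1{d_k}\sum_{j}f(\phi(j),\psi(j))-\int f\,d(\mu\otimes\mu)|<\varepsilon\})\to1$. *)

(* Defs.v *)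
From HB Require Import structures.
From mathcomp Require Import all_boot all_order all_algebra all_fingroup.
From mathcomp Require Import all_classical all_reals all_analysis.

Set Implicit Arguments.
Unset Strict Implicit.
Unset Printing Implicit Defensive.

Import Order.TTheory GRing.Theory Num.Theory.
Import numFieldNormedType.Exports.

Local Open Scope classical_set_scope.
Local Open Scope ring_scope.

HB.mixin Record isTopologicalGroup T of monoid.Group T & PointedTopological T := {
  mulg_continuous : continuous (fun p : T * T => (p.1 * p.2)%g) ;
  invg_continuous : continuous (fun x : T => (x^-1)%g)
}.

#[short(type="topologicalGroupType")]
HB.structure Definition TopologicalGroup :=
  {T of monoid.Group T & PointedTopological T & isTopologicalGroup T}.

(* [metricType] carries a chosen metric, whereas metrizability is a property of
   the topology. *)
Definition metrizable (R : realType) (T : topologicalType) : Prop :=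
  exists (M : metricType R) (f : T -> M) (g : M -> T),
    [/\ cancel f g, cancel g f, continuous f & continuous g].

Notation borel T := (g_sigma_algebraType (@open T)).

Notation Prob R T := (probability (borel T) R).

(* The weak* topology on Prob(T) is the initial topology of the map sending
   nu to the functional f |-> \int f dnu, the space of functionals on C(T)
   having the topology of pointwise convergence. *)
Definition integration (R : realType) (T : ptopologicalType) (nu : Prob R T) :
    {ptws continuousType T R -> R} :=
  fun f => \int[nu]_x f x.

Definition weak_star (R : realType) (T : ptopologicalType) : Type :=
  initial_topology (@integration R T).

HB.instance Definition _ (R : realType) (T : ptopologicalType) :=
  Topological.copy (weak_star R T) (initial_topology (@integration R T)).

(* A left-invariant Borel probability measure; on a compact group it is unique
   and it is also right-invariant. *)
Definition is_haar (R : realType) (X : topologicalGroupType) (m : Prob R X) :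
    Prop :=
  forall (x : X) (A : set (borel X)), measurable A ->
    m [set y | A (x * y)%g] = m A.

Definition power (n : nat) (T : Type) : Type := {ptws 'I_n -> T}.

HB.instance Definition _ (n : nat) (T : topologicalType) :=
  Topological.copy (power n T) {ptws 'I_n -> T}.
HB.instance Definition _ (n : nat) (T : pointedType) :=
  Pointed.copy (power n T) ('I_n -> T).
HB.instance Definition _ (n : nat) (T : ptopologicalType) :=
  Pointed.on (power n T).

Definition coordinate (n : nat) (T : ptopologicalType) (j : 'I_n)
  (phi : borel (power n T)) : borel T := phi j.

Lemma measurable_coordinate (n : nat) (T : ptopologicalType) (j : 'I_n) :
  measurable_fun setT (@coordinate n T j).
Proof.
apply: (@measurability _ _ _ _ setT (@coordinate n T j) (@open T)) => //.
move=> _ [B oB <-]; rewrite setTI; apply: sub_sigma_algebra.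
by apply: open_comp oB => phi _; exact: (@proj_continuous 'I_n (fun=> T) j).
Qed.

HB.instance Definition _ (n : nat) (T : ptopologicalType) (j : 'I_n) :=
  isMeasurableFun.Build _ _ _ _ (@coordinate n T j)
    (measurable_coordinate j).

Definition marginal (R : realType) (n : nat) (T : ptopologicalType)
    (nu : Prob R (power n T)) (j : 'I_n) : Prob R T :=
  distribution nu (@coordinate n T j).

Definition unif (R : realType) (n : nat) (A : set 'I_n) : R :=
  #|[pred j | j \in A]|%:R / n%:R.
Arguments unif R {n} A.

Definition d_hamm (R : realType) (n : nat) (p q : 'S_n) : R :=
  unif R [set j | p j <> q j].
Arguments d_hamm R {n} p q.

(* Products in 'S_n are composed from left to right: (q * p) j = p (q j), so
   that the composite of sigma g after sigma h is sigma h * sigma g. *)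
Definition sofic_approximation (R : realType) (G : groupType) (d : nat -> nat)
    (sigma : forall k, G -> 'S_(d k)) : Prop :=
  [/\ d @ \oo --> \oo,
      forall g h : G, d_hamm R (sigma k (g * h)%g) (sigma k h * sigma k g)%g
        @[k --> \oo] --> (0 : R)
    & forall g h : G, g <> h ->
        d_hamm R (sigma k g) (sigma k h) @[k --> \oo] --> (1 : R)].
Arguments sofic_approximation R {G d} sigma.

Definition is_group_action (G : groupType) (X : Type) (act : G -> X -> X) :
    Prop :=
  (forall x, act 1%g x = x) /\
  (forall g h x, act (g * h)%g x = act g (act h x)).

Definition algebraic_action (R : realType) (G : groupType)
    (X : topologicalGroupType) (act : G -> X -> X) : Prop :=
  [/\ compact [set: X], metrizable R X, is_group_action act,
      forall g, continuous (act g)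
    & forall g x y, act g (x * y)%g = (act g x * act g y)%g].
Arguments algebraic_action R {G X} act.

(* Automorphisms of a compact group preserve its Haar measure, so the
   invariance of m under the action is not repeated here. *)
Definition ergodic (R : realType) (G : groupType) (X : ptopologicalType)
    (act : G -> X -> X) (m : Prob R X) : Prop :=
  forall A : set (borel X), measurable A ->
    (forall g, act g @^-1` A = A) -> m A = 0%E \/ m A = 1%E.

Definition topological_factor (G : groupType) (X Y : topologicalType)
    (actX : G -> X -> X) (actY : G -> Y -> Y) : Prop :=
  exists p : X -> Y,
    [/\ continuous p, forall g x, p (actX g x) = actY g (p x)
      & set_surj setT setT p].

(* In the second condition, U ranges over the Borel neighborhoods of the
   diagonal, so that the event whose probability is taken is measurable. *)
Definition strongly_sofic (R : realType) (G : groupType) (X : ptopologicalType)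
    (act : G -> X -> X) (m : Prob R X) (d : nat -> nat)
    (sigma : forall k, G -> 'S_(d k)) : Prop :=
  exists mu : forall k, Prob R (power (d k) X),
    [/\ forall O : set (weak_star R X), nbhs (m : weak_star R X) O ->
          unif R [set j | O (marginal (mu k) j)] @[k --> \oo] --> (1 : R),
        forall (g : G) (delta : R) (U : set (borel X * borel X)),
          0 < delta -> measurable U -> (forall x : X, nbhs (x, x) U) ->
          mu k [set phi | 1 - delta <=
                  unif R [set j | U (phi (sigma k g j), act g (phi j))]]
            @[k --> \oo] --> 1%E
      & forall (f : X * X -> R) (eps : R), continuous f -> 0 < eps ->
          (mu k \x mu k)%E
            [set q | `| (d k)%:R^-1 * \sum_(j < d k) f (q.1 j, q.2 j)
                        - \int[(m \x m)%E]_z f z | < eps]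
            @[k --> \oo] --> 1%E].

(* Main.v *)
(* Pushing the sampling measures forward along the factor map [p] samples the
   image of the Haar measure of [X], which is not the Haar measure of [Y] but has
   full support, so its convolution powers converge to it (Kawada-Ito).  By double
   empirical convergence, a function [f] with integral zero sampled along [phi] has
   a covariance operator of small Hilbert-Schmidt norm, so its average against any
   bounded deterministic weights is small in mean.  This turns convergence for two
   samples into convergence for any number of independent samples, hence products
   of [n] independent samples on [Y] sample the [n]-th convolution power, and
   multiplication being uniformly continuous they are still almost equivariant.
   A diagonal argument over [n] gives the Haar measure.  All the sampling measures
   are first rounded to finitely supported ones. *)
From mathcomp Require Import all_boot all_order all_algebra all_fingroup.
From mathcomp Require Import all_classical all_reals all_analysis.
From mathcomp Require Import measurable_realfun ring lra.
Require Import Defs.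

Set Implicit Arguments.
Unset Strict Implicit.
Unset Printing Implicit Defensive.

Import Order.TTheory GRing.Theory Num.Theory.
Import numFieldNormedType.Exports.

Local Open Scope classical_set_scope.
Local Open Scope ring_scope.

(** Double convergence compares two copies of one law, whereas a product of samples pairs different
    laws. The property carried through the proof therefore has to survive pairing: weighted averages
    concentrate uniformly over all weights bounded by 1, so that a value of one sample can be frozen
    into the weight of the other. A factor map that is not a homomorphism transports no invariance;
    what remains of the Haar measure of [X] is full support, by surjectivity, and this is all that
    is needed for convolution to contract oscillations strictly. Limit measures are handled as
    positive functionals on continuous functions, so that a single tool, separation of variables by
    a partition of unity, gives Fubini, the pairing of samples, and the reduction of concentration
    to countably many tests, without which no diagonal sequence could be chosen. Rounding makes
    every expectation over maps a finite sum, at the cost of an error below [1/(k+1)] in each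
    coordinate. *)

(** * Metrics compatible with a compact topology *)

Section CompatibleMetric.
Context {R : realType}.

(** The metric is a plain function beside the given topology, so [T] needs no second structure.
    [cmetric_diagonal] is the Lebesgue number property, the source of uniform continuity below. *)
Record compatible_metric (T : topologicalType) (rho : T -> T -> R) : Prop := {
  cmetric_continuous : continuous (fun q : T * T => rho q.1 q.2);
  cmetric_xx : forall x, rho x x = 0;
  cmetric_sym : forall x y, rho x y = rho y x;
  cmetric_triangle : forall y x z, rho x z <= rho x y + rho y z;
  cmetric_diagonal : forall U : set (T * T), (forall x : T, nbhs (x, x) U) ->
    exists2 eta, 0 < eta & forall x y, rho x y < eta -> U (x, y) }.

(** The tube lemma for filters; it yields the uniform bounds, moduli and Lebesgue numbers on compact
    spaces. *)
Lemma compact_forall_near (T : topologicalType) (I : Type) (F : set_system I)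
    (P : I -> T -> Prop) : compact [set: T] -> Filter F ->
  (forall x : T, \forall x' \near x & i \near F, P i x') ->
  \forall i \near F, forall x, P i x.
Proof.
move=> /compact_near_coveringP cT FF h.
have := cT I F P FF (fun x _ => h x).
by apply: filterS => i hi x; exact: hi.
Qed.

Lemma mdist_continuous (M : metricType R) :
  continuous (fun q : M * M => mdist q.1 q.2).
Proof.
move=> [a b]; apply/cvgrPdist_lt => e e0.
have e2 : 0 < e / 2 by rewrite divr_gt0.
exists (ball a (e / 2), ball b (e / 2)).
  by split => /=; exact: nbhsx_ballx.
move=> [x y] /= []; rewrite !ballEmdist /= => ax bY.
rewrite ltr_norml; apply/andP; split.
  have := metric_triangle x a y; have := metric_triangle a b y.
  rewrite (metric_sym x a); lra.
have := metric_triangle a x b; have := metric_triangle x y b.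
rewrite (metric_sym y b); lra.
Qed.

Lemma metrizable_compatible (T : topologicalType) :
  compact [set: T] -> metrizable R T ->
  exists rho : T -> T -> R, compatible_metric rho.
Proof.
move=> cT [M [f [g [fK gK cf cg]]]].
exists (fun x y => mdist (f x) (f y)); split.
- move=> [a b].
  apply: (@continuous_comp _ _ _ (fun q : T * T => (f q.1, f q.2))
            (fun q : M * M => mdist q.1 q.2)).
    apply: cvg_pair; apply: continuous_comp;
      [exact: cvg_fst|exact: cf|exact: cvg_snd|exact: cf].
  exact: mdist_continuous.
- by move=> x; exact: mdistxx.
- by move=> x y; exact: metric_sym.
- by move=> x y z; exact: metric_triangle.
- move=> U hU.
  have : \forall e \near 0^'+, forall x, (fun (e : R) x =>
      forall y, mdist (f x) (f y) < e -> U (x, y)) e x.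
    apply: compact_forall_near => // x.
    have [[A B] /= [Ax Bx] ABU] := hU x.
    have : nbhs (f x) (g @^-1` B).
      by apply: cg; rewrite fK.
    rewrite -nbhs_ballE => -[e /= e0 eB].
    have e2 : 0 < e / 2 by rewrite divr_gt0.
    have N1 : nbhs x (A `&` f @^-1` (ball (f x) (e / 2))).
      by apply: filterI => //; apply: cf; exact: nbhsx_ballx.
    (* The radius [e] is shared: [x'] lies within [e / 2] of [x] and [y] within [e / 2] of [x'], so
       [y] lands in [B]. *)
    exists (A `&` f @^-1` (ball (f x) (e / 2)), [set r | r < e / 2]).
      by split => //=; exact: nbhs_right_lt.
    move=> [x' r] /= [[Ax']]; rewrite ballEmdist /= => xx' re y yr.
    apply: (ABU (x', y)); split => //=.
    rewrite -(fK y); apply: eB; rewrite ballEmdist /=.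
    have := metric_triangle (f x) (f x') (f y); lra.
  move=> h; have : \forall e \near (0:R)^'+, 0 < e /\ (forall x y,
      mdist (f x) (f y) < e -> U (x, y)).
    by near=> e; split; [near: e; exact: nbhs_right_gt|near: e].
  by move=> /filter_ex [e [e0 he]]; exists e.
Unshelve. all: by end_near. Qed.

End CompatibleMetric.

Lemma continuous_sum (R : realType) (T : topologicalType) (I : Type) (r : seq I)
    (f : I -> T -> R) : (forall i, continuous (f i)) ->
  continuous (fun x => \sum_(i <- r) f i x).
Proof.
move=> cf; elim: r => [|i r IH].
  by under eq_fun do rewrite big_nil; move=> x; exact: cvg_cst.
under eq_fun do rewrite big_cons.
by move=> x; apply: cvgD; [exact: cf|exact: IH].
Qed.

Lemma continuous_bounded (R : realType) (T : topologicalType) (f : T -> R) :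
  compact [set: T] -> continuous f ->
  exists2 M, 0 < M & forall x, `|f x| <= M.
Proof.
move=> cT cf.
have h : \forall M \near +oo, forall x, (fun M x => `|f x| <= M) M x.
  apply: compact_forall_near => // x.
  have N : nbhs x [set y | `|f x - f y| < 1].
    by have /cvgrPdist_lt := cf x; apply.
  exists ([set y | `|f x - f y| < 1], [set M | `|f x| + 1 < M]).
    by split => //=; exact: nbhs_pinfty_gt.
  move=> [y M] /= [xy hM]; have := ler_normB (f x) (f x - f y).
  by rewrite opprB addrC subrK => /le_trans; apply; lra.
have : \forall M \near +oo, 0 < M /\ forall x, `|f x| <= M.
  by near=> M; split; [near: M; exact: nbhs_pinfty_gt|near: M].
by move=> /filter_ex [M [M0 hM]]; exists M.
Unshelve. all: by end_near. Qed.

(** * Partitions of unity and separation of variables *)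

Section PartitionOfUnity.
Context {R : realType} {T : ptopologicalType}.

Variable rho : T -> T -> R.
Hypothesis rhoP : compatible_metric rho.

Lemma cmetric_continuousr c : continuous (rho c).
Proof.
move=> x; apply: (@continuous_comp _ _ _ (fun y => (c, y)) (fun q => rho q.1 q.2)).
  by apply: cvg_pair; [exact: cvg_cst|exact: cvg_id].
exact: cmetric_continuous.
Qed.

Lemma open_cball c (r : R) : open [set x | rho c x < r].
Proof.
rewrite -[X in open X]/(rho c @^-1` [set y | y < r]).
by apply: open_comp; [move=> x _; exact: cmetric_continuousr|exact: open_lt].
Qed.

Hypothesis cT : compact [set: T].

Lemma finite_net (eta : R) : 0 < eta ->
  exists s : seq T, forall x, exists2 c, c \in s & rho c x < eta.
Proof.
move=> eta0; have := cT; rewrite compact_cover => cov.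
have [|x _|D _ hD] := cov T setT (fun c => [set x | rho c x < eta]).
- by move=> c _; exact: open_cball.
- by exists x => //=; rewrite (cmetric_xx rhoP).
exists (finmap.enum_fset D) => x.
by have [//|c /= cD cx] := hD x; exists c.
Qed.

(** Continuity, positivity and support are required for all [c], also outside [s], so they apply
    under a sum over [s] without a membership condition. *)
Record partition_of_unity (eta : R) (s : seq T) (lam : T -> T -> R) : Prop := {
  pou_continuous : forall c, continuous (lam c);
  pou_ge0 : forall c x, 0 <= lam c x;
  pou_sum : forall x, \sum_(c <- s) lam c x = 1;
  pou_supp : forall c x, eta <= rho c x -> lam c x = 0 }.

Lemma partition_of_unity_exists (eta : R) : 0 < eta ->
  exists s lam, partition_of_unity eta s lam.
Proof.
move=> eta0; have [s hs] := finite_net eta0.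
(* Tent functions around the points of an [eta]-net; the net property makes their sum positive
   everywhere, so it can be divided out. *)
pose b c x := Num.max 0 (eta - rho c x).
have b0 c x : 0 <= b c x by rewrite /b le_max lexx.
have cb c : continuous (b c).
  move=> x; apply: (@continuous_max R T (fun=> 0) (fun x => eta - rho c x) x).
    exact: cvg_cst.
  by apply: cvgB; [exact: cvg_cst|exact: cmetric_continuousr].
pose S x := \sum_(c <- s) b c x.
have S0 x : 0 < S x.
  have [c cs cx] := hs x; rewrite /S (big_rem c cs) /=.
  apply: ltr_wpDr; first by apply: sumr_ge0 => i _.
  by rewrite /b lt_max subr_gt0 cx orbT.
have cS : continuous S.
  exact: continuous_sum.
exists s, (fun c x => b c x / S x); split.
- move=> c x; apply: cvgM; first exact: cb.
  by apply: cvgV; [rewrite gt_eqF|exact: cS].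
- by move=> c x; apply: divr_ge0 => //; exact: ltW.
- by move=> x; rewrite -mulr_suml -/(S x) divff // gt_eqF.
- move=> c x cx; rewrite /b; suff /max_idPl -> : eta - rho c x <= 0 by rewrite mul0r.
  by rewrite subr_le0.
Qed.

Lemma pou_le1 (eta : R) s lam : partition_of_unity eta s lam ->
  forall c x, c \in s -> lam c x <= 1.
Proof.
move=> h c x cs; rewrite -(pou_sum h x) (big_rem c cs) /= lerDl.
by apply: sumr_ge0 => i _; exact: (pou_ge0 h).
Qed.

(** The tube lemma over [B] makes the set of good pairs [(a, a')] a neighborhood of the diagonal,
    and [cmetric_diagonal] turns it into a radius. *)
Lemma uniform_close (B : topologicalType) (F : T * B -> R) (e : R) :
  compact [set: B] -> continuous F -> 0 < e ->
  exists2 eta, 0 < eta &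
    forall a a', rho a a' < eta -> forall b, `|F (a, b) - F (a', b)| <= e.
Proof.
move=> cB cF e0.
apply: (cmetric_diagonal rhoP
  (U := [set q | forall b, `|F (q.1, b) - F (q.2, b)| <= e])) => a.
apply: (@compact_forall_near _ _ (nbhs (a, a))
  (fun q b => `|F (q.1, b) - F (q.2, b)| <= e)) => // b.
have : {for (b, (a, a)), continuous (fun z : B * (T * T) =>
    F (z.2.1, z.1) - F (z.2.2, z.1))}.
  apply: cvgB.
    apply: (@continuous_comp _ _ _ (fun z : B * (T * T) => (z.2.1, z.1)) F).
      apply: cvg_pair; last exact: cvg_fst.
      by apply: (@cvg_comp _ _ _ snd fst); [exact: cvg_snd|exact: cvg_fst].
    exact: cF.
  apply: (@continuous_comp _ _ _ (fun z : B * (T * T) => (z.2.2, z.1)) F).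
    apply: cvg_pair; last exact: cvg_fst.
    by apply: (@cvg_comp _ _ _ snd snd); [exact: cvg_snd|exact: cvg_snd].
  exact: cF.
move=> /cvgrPdist_le /(_ e e0).
by apply: filterS => -[b' [x y]] /=; rewrite subrr sub0r normrN.
Qed.

(** [F (a, b)] is compared with a convex combination of the values [F (c, b)], in which only centres
    [c] close to [a] have weight. The result is a finite sum of products of one-variable
    functions. *)
Lemma tensor_approx (B : Type) (F : T * B -> R) (e eta : R) s lam :
  partition_of_unity eta s lam ->
  (forall a a', rho a a' < eta -> forall b, `|F (a, b) - F (a', b)| <= e) ->
  forall a b, `|F (a, b) - \sum_(c <- s) lam c a * F (c, b)| <= e.
Proof.
move=> hp hF a b.
rewrite -[X in X - _]mul1r -(pou_sum hp a) mulr_suml -sumrB.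
rewrite (le_trans (ler_norm_sum _ _ _)) //.
rewrite -[leRHS]mul1r -(pou_sum hp a) mulr_suml; apply: ler_sum => c _.
rewrite -mulrBr normrM ger0_norm ?(pou_ge0 hp) //.
have [hca|hca] := leP eta (rho c a); first by rewrite (pou_supp hp hca) !mul0r.
by apply: ler_wpM2l; [exact: (pou_ge0 hp)|rewrite distrC; exact: hF].
Qed.

End PartitionOfUnity.

(** * Means: probability measures as positive functionals *)

Section Mean.
Context {R : realType}.

(** On a compact metrizable space these are the Borel probability measures, by Riesz. Only the
    values on continuous functions are constrained. *)
Record is_mean (T : topologicalType) (L : (T -> R) -> R) : Prop := {
  meanD : forall f g, continuous f -> continuous g ->
    L (fun x => f x + g x) = L f + L g;
  meanZ : forall (a : R) f, continuous f -> L (fun x => a * f x) = a * L f;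
  mean_le : forall f g, continuous f -> continuous g ->
    (forall x, f x <= g x) -> L f <= L g;
  mean1 : L (fun=> 1) = 1 }.

Section MeanTheory.
Context {T : topologicalType} {L : (T -> R) -> R}.
Hypothesis hL : is_mean L.

Lemma continuous_scale (a : R) (f : T -> R) :
  continuous f -> continuous (fun x => a * f x).
Proof. by move=> cf x; apply: cvgM; [exact: cvg_cst|exact: cf]. Qed.

Lemma mean_cst (a : R) : L (fun=> a) = a.
Proof.
rewrite -[RHS]mulr1 -(mean1 hL) -(meanZ hL); last by move=> x; exact: cvg_cst.
by under [in RHS]eq_fun do rewrite mulr1.
Qed.

Lemma mean_sum (I : Type) (r : seq I) (a : I -> R) (f : I -> T -> R) :
  (forall i, continuous (f i)) ->
  L (fun x => \sum_(i <- r) a i * f i x) = \sum_(i <- r) a i * L (f i).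
Proof.
move=> cf; elim: r => [|i r IH].
  by under eq_fun do rewrite big_nil; rewrite big_nil mean_cst.
under eq_fun do rewrite big_cons; rewrite big_cons.
rewrite (meanD hL) ?(meanZ hL) ?IH //; first exact: continuous_scale.
by apply: continuous_sum => j; exact: continuous_scale.
Qed.

Lemma mean_close f g e : continuous f -> continuous g ->
  (forall x, `|f x - g x| <= e) -> `|L f - L g| <= e.
Proof.
move=> cf cg h.
have ce : continuous (fun _ : T => e) by move=> x; exact: cvg_cst.
have cD (u : T -> R) : continuous u -> continuous (fun x => u x + e).
  by move=> cu x; apply: cvgD; [exact: cu|exact: ce].
have Le u : continuous u -> L (fun x => u x + e) = L u + e.
  by move=> cu; rewrite (meanD hL) // mean_cst.
have h1 : L f <= L g + e.
  rewrite -Le //; apply: (mean_le hL) => //; first exact: cD.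
  by move=> x; have := h x; rewrite ler_norml => /andP[]; lra.
have h2 : L g <= L f + e.
  rewrite -Le //; apply: (mean_le hL) => //; first exact: cD.
  by move=> x; have := h x; rewrite ler_norml => /andP[]; lra.
by rewrite ler_norml; apply/andP; split; lra.
Qed.

End MeanTheory.

(** By the tube lemma [F (a', _)] is uniformly close to [F (a, _)] for [a'] near [a], and a mean is
    a contraction for the uniform norm. *)
Lemma mean_continuous (A B : topologicalType) (L : (B -> R) -> R)
    (F : A * B -> R) : compact [set: B] -> is_mean L -> continuous F ->
  continuous (fun a => L (fun b => F (a, b))).
Proof.
move=> cB hL cF a; apply/cvgrPdist_le => e e0.
have cFa a' : continuous (fun b => F (a', b)).
  move=> b; apply: (@continuous_comp _ _ _ (fun b => (a', b)) F); last exact: cF.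
  by apply: cvg_pair; [exact: cvg_cst|exact: cvg_id].
suff : \forall a' \near a, forall b, (fun a' b => `|F (a, b) - F (a', b)| <= e) a' b.
  by apply: filterS => a' ha; apply: (mean_close hL).
apply: compact_forall_near => // b.
have : {for (b, a), continuous (fun z : B * A => F (a, z.1) - F (z.2, z.1))}.
  apply: cvgB.
    apply: (@continuous_comp _ _ _ (fun z : B * A => (a, z.1)) F); last exact: cF.
    by apply: cvg_pair; [exact: cvg_cst|exact: cvg_fst].
  apply: (@continuous_comp _ _ _ (fun z : B * A => (z.2, z.1)) F); last exact: cF.
  by apply: cvg_pair; [exact: cvg_snd|exact: cvg_fst].
move=> /cvgrPdist_le /(_ e e0).
by apply: filterS => -[b' x] /=; rewrite subrr sub0r normrN.
Qed.

Lemma continuous_section (A B : topologicalType) (F : A * B -> R) :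
  continuous F -> (forall a, continuous (fun b => F (a, b))) /\
                  (forall b, continuous (fun a => F (a, b))).
Proof.
move=> cF; split=> [a b|b a].
  apply: (@continuous_comp _ _ _ (fun b => (a, b)) F); last exact: cF.
  by apply: cvg_pair; [exact: cvg_cst|exact: cvg_id].
apply: (@continuous_comp _ _ _ (fun a => (a, b)) F); last exact: cF.
by apply: cvg_pair; [exact: cvg_id|exact: cvg_cst].
Qed.

Lemma continuous_swap (A B : topologicalType) (F : A * B -> R) :
  continuous F -> continuous (fun z : B * A => F (z.2, z.1)).
Proof.
move=> cF z; apply: (@continuous_comp _ _ _ (fun z : B * A => (z.2, z.1)) F).
  by apply: cvg_pair; [exact: cvg_snd|exact: cvg_fst].
exact: cF.
Qed.

Section MeanFubini.
Context {T : ptopologicalType} {B : topologicalType} {rho : T -> T -> R}.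
Variables (L : (T -> R) -> R) (H : (B -> R) -> R).
Hypotheses (rhoP : compatible_metric rho) (cT : compact [set: T])
  (cB : compact [set: B]) (hL : is_mean L) (hH : is_mean H).

Lemma mean_tensor_approx (F : T * B -> R) (e eta : R) s lam :
  continuous F -> partition_of_unity rho eta s lam ->
  (forall a a', rho a a' < eta -> forall b, `|F (a, b) - F (a', b)| <= e) ->
  `|H (fun b => L (fun a => F (a, b)))
    - \sum_(c <- s) L (lam c) * H (fun b => F (c, b))| <= e.
Proof.
move=> cF hp hF; have [c1 c2] := continuous_section cF.
rewrite -(mean_sum hH) //; apply: (mean_close hH).
- exact: (mean_continuous cT hL (continuous_swap cF)).
- by apply: continuous_sum => c; exact: continuous_scale.
move=> b.
under [X in _ - X]eq_bigr do rewrite mulrC.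
rewrite -(mean_sum hL); last exact: pou_continuous hp.
apply: (mean_close hL) => //.
  by apply: continuous_sum => c; apply: continuous_scale; exact: pou_continuous hp _.
move=> a; under [X in _ - X]eq_bigr do rewrite mulrC.
exact: tensor_approx hp hF a b.
Qed.

(** Both iterated means are within [e / 2] of the same finite sum over a partition of unity. *)
Lemma mean_fubini (F : T * B -> R) : continuous F ->
  H (fun b => L (fun a => F (a, b))) = L (fun a => H (fun b => F (a, b))).
Proof.
move=> cF; apply/eqP; rewrite -subr_eq0 -normr_le0.
apply/ler_addgt0Pr => e e0; rewrite add0r.
have [c1 c2] := continuous_section cF.
have e2 : 0 < e / 2 by rewrite divr_gt0.
have [eta eta0 hF] := uniform_close rhoP cB cF e2.
have [s [lam hp]] := partition_of_unity_exists rhoP cT eta0.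
have h1 := mean_tensor_approx cF hp hF.
have h2 : `|L (fun a => H (fun b => F (a, b)))
    - \sum_(c <- s) L (lam c) * H (fun b => F (c, b))| <= e / 2.
  under [X in _ - X]eq_bigr do rewrite mulrC.
  rewrite -(mean_sum hL); last exact: pou_continuous hp.
  apply: (mean_close hL).
  - exact: (mean_continuous cB hH cF).
  - by apply: continuous_sum => c; apply: continuous_scale; exact: pou_continuous hp _.
  move=> a; under [X in _ - X]eq_bigr do rewrite mulrC.
  rewrite -(mean_sum hH) //; apply: (mean_close hH) => //.
    by apply: continuous_sum => c; exact: continuous_scale.
  by move=> b; exact: tensor_approx hp hF a b.
move: h1 h2; rewrite !ler_norml => /andP[? ?] /andP[? ?].
by apply/andP; split; lra.
Qed.

End MeanFubini.
End Mean.

(** * Convergence of convolution powers to the invariant mean *)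

Section KawadaIto.
Context {R : realType} {Y : topologicalGroupType} {rho : Y -> Y -> R}.
Hypotheses (cY : compact [set: Y]) (rhoP : compatible_metric rho).

(** Full support of the measure behind [L]. *)
Definition strictly_positive (T : topologicalType) (L : (T -> R) -> R) : Prop :=
  forall f : T -> R, continuous f -> (forall x, 0 <= f x) -> (exists x, 0 < f x) -> 0 < L f.

Definition left_invariant (L : (Y -> R) -> R) : Prop :=
  forall (s : Y) (f : Y -> R), continuous f -> L (fun y => f (s * y)%g) = L f.

Lemma mulg_cvg (A : topologicalType) (u v : A -> Y) (a : A) :
  {for a, continuous u} -> {for a, continuous v} ->
  {for a, continuous (fun x => (u x * v x)%g)}.
Proof.
move=> cu cv.
apply: (@continuous_comp _ _ _ (fun x => (u x, v x)) (fun p : Y * Y => (p.1 * p.2)%g)).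
  exact: cvg_pair.
exact: mulg_continuous.
Qed.

Lemma continuous_translate (s : Y) (f : Y -> R) :
  continuous f -> continuous (fun y => f (s * y)%g).
Proof.
move=> cf y; apply: (@continuous_comp _ _ _ (fun y => (s * y)%g) f); last exact: cf.
by apply: mulg_cvg; [exact: cvg_cst|exact: cvg_id].
Qed.

(* Finitely many translates of [f] add up to a function bounded below. *)
Lemma invariant_strictly_positive (L : (Y -> R) -> R) :
  is_mean L -> left_invariant L -> strictly_positive L.
Proof.
move=> hL iL f cf f0 [x0 fx0].
have := cY; rewrite compact_cover => /(_ Y setT (fun s : Y =>
  [set y | f x0 / 2 < f (s * y)%g])).
case=> [s _|y _|D _ hD].
- rewrite -[X in open X]/((fun y => f (s * y)%g) @^-1` [set r | f x0 / 2 < r]).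
  by apply: open_comp; [move=> y _; exact: continuous_translate|exact: open_gt].
- exists (x0 * y^-1)%g => //=; rewrite mulgKV; lra.
(* The factors [1] put the sum in the shape of [mean_sum]. All translates have mean [L f], so
   [L f = 0] would contradict the bound [f x0 / 2]. *)
pose S y := \sum_(s <- finmap.enum_fset D) 1 * f (s * y)%g.
have hS y : f x0 / 2 <= S y.
  have [//|c /= cD /ltW cy] := hD y; apply: le_trans cy _.
  rewrite /S (big_rem c) //= mul1r lerDl; apply: sumr_ge0 => i _.
  by rewrite mul1r.
have : f x0 / 2 <= L S.
  rewrite -[leLHS](mean_cst hL); apply: (mean_le hL) => //.
    by move=> y; exact: cvg_cst.
  by apply: continuous_sum => s; apply: continuous_scale; exact: continuous_translate.
rewrite (mean_sum hL); last by move=> s; exact: continuous_translate.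
under eq_bigr do rewrite mul1r iL //.
rewrite big_const_seq iter_addr addr0 => h.
have Lf0 : 0 <= L f.
  by rewrite -(mean_cst hL 0); apply: (mean_le hL) => // y; exact: cvg_cst.
rewrite lt_neqAle Lf0 andbT; apply/eqP => Lf.
move: h; rewrite -Lf mul0rn; lra.
Qed.

Variable L : (Y -> R) -> R.
Hypothesis hL : is_mean L.

(** The Markov operator of the random walk with step law [L]: [iter n convolve f 1] is the integral
    of [f] against the [n]-th convolution power of [L]. *)
Definition convolve (f : Y -> R) (y : Y) : R := L (fun x => f (x * y)%g).

Lemma continuous_mul2 (f : Y -> R) : continuous f ->
  continuous (fun q : Y * Y => f (q.1 * q.2)%g).
Proof.
move=> cf q; apply: (@continuous_comp _ _ _ (fun q : Y * Y => (q.1 * q.2)%g) f).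
  exact: mulg_continuous.
exact: cf.
Qed.

Lemma continuous_translater (s : Y) (f : Y -> R) :
  continuous f -> continuous (fun y => f (y * s)%g).
Proof.
by move=> cf; have [_ /(_ s)] := continuous_section (continuous_mul2 cf).
Qed.

Lemma convolve_continuous f : continuous f -> continuous (convolve f).
Proof.
move=> /continuous_mul2/continuous_swap cf.
exact: (mean_continuous cY hL cf).
Qed.

Lemma iter_convolve_continuous n f :
  continuous f -> continuous (iter n convolve f).
Proof. by move=> cf; elim: n => //= n; exact: convolve_continuous. Qed.

Lemma iter_convolve_is_mean n : is_mean (fun f => iter n convolve f 1%g).
Proof.
(* Stated for whole functions rather than at [1], so that the induction can rewrite under the next
   [convolve]. *)
suff h : [/\ forall f g : Y -> R, continuous f -> continuous g ->
    iter n convolve (fun x => f x + g x) =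
      (fun x => iter n convolve f x + iter n convolve g x),
    forall a (f : Y -> R), continuous f ->
      iter n convolve (fun x => a * f x) = (fun x => a * iter n convolve f x),
    forall f g : Y -> R, continuous f -> continuous g -> (forall x, f x <= g x) ->
      forall x, iter n convolve f x <= iter n convolve g x
    & iter n convolve (fun=> 1) = (fun=> 1)].
  case: h => h1 h2 h3 h4; split.
  - by move=> f g cf cg; rewrite h1.
  - by move=> a f cf; rewrite h2.
  - by move=> f g cf cg fg; exact: h3.
  - by rewrite h4.
elim: n => //= n [h1 h2 h3 h4]; split.
- move=> f g cf cg; rewrite h1 //; apply/funext => y.
  by rewrite /convolve (meanD hL) //; apply: continuous_translater;
    exact: iter_convolve_continuous.
- move=> a f cf; rewrite h2 //; apply/funext => y.
  by rewrite /convolve (meanZ hL) //; apply: continuous_translater;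
    exact: iter_convolve_continuous.
- move=> f g cf cg fg x; apply: (mean_le hL) => [||y]; last exact: h3.
  + by apply: continuous_translater; exact: iter_convolve_continuous.
  + by apply: continuous_translater; exact: iter_convolve_continuous.
- by rewrite h4; apply/funext => y; exact: mean1 hL.
Qed.

(* A modulus of continuity that survives two-sided translations, hence also
   convolutions. *)
Definition equicontinuous_by (eta e : R) (f : Y -> R) : Prop :=
  forall a b y y', rho y y' < eta -> `|f (a * y * b)%g - f (a * y' * b)%g| <= e.

Lemma equicontinuous_by_exists f e : continuous f -> 0 < e ->
  exists2 eta, 0 < eta & equicontinuous_by eta e f.
Proof.
move=> cf e0.
have cF : continuous (fun q : Y * (Y * Y) => f (q.2.1 * q.1 * q.2.2)%g).
  move=> q; apply: (@continuous_comp _ _ _ (fun q : Y * (Y * Y) =>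
    (q.2.1 * q.1 * q.2.2)%g) f); last exact: cf.
  apply: mulg_cvg.
    apply: mulg_cvg; last exact: cvg_fst.
    by apply: (@cvg_comp _ _ _ snd fst); [exact: cvg_snd|exact: cvg_fst].
  by apply: (@cvg_comp _ _ _ snd snd); [exact: cvg_snd|exact: cvg_snd].
have cYY : compact [set: Y * Y].
  by rewrite -setXTT; exact: compact_setX.
have [eta eta0 h] := uniform_close rhoP cYY cF e0.
by exists eta => // a b y y' yy'; exact: (h y y' yy' (a, b)).
Qed.

Lemma equicontinuous_by_convolve eta e f : continuous f ->
  equicontinuous_by eta e f -> equicontinuous_by eta e (convolve f).
Proof.
move=> cf h a b y y' yy'; apply: (mean_close hL).
- exact: continuous_translater.
- exact: continuous_translater.
by move=> x; rewrite !mulgA; exact: h.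
Qed.

Hypothesis Lpos : strictly_positive L.

(** A minimum of finitely many positive means. Functions that vanish identically are left out, since
    full support gives them no positive mean. *)
Lemma pou_mean_lower_bound (eta : R) s lam : partition_of_unity rho eta s lam ->
  exists c0, [/\ 0 < c0, c0 <= 1 &
    forall c, c \in s -> (exists y, 0 < lam c y) -> c0 <= L (lam c)].
Proof.
move=> hp; elim: s {hp} (pou_continuous hp) (pou_ge0 hp) => [|c s IH] cl l0.
  by exists 1; split.
have [c0 [c00 c01 h]] := IH cl l0.
have [hc|hc] := pselect (exists y, 0 < lam c y); last first.
  exists c0; split => // c'; rewrite inE => /orP[/eqP -> //|]; exact: h.
have Lc := Lpos (cl c) (l0 c) hc.
exists (Num.min c0 (L (lam c))); split.
- by rewrite lt_min c00.
- by rewrite ge_min c01.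
- move=> c'; rewrite inE => /orP[/eqP -> _|c's hc'].
    by rewrite ge_min lexx orbT.
  by rewrite ge_min h.
Qed.

Definition oscillation_le (g : Y -> R) (O : R) := forall x x', g x - g x' <= O.

(* [convolve g x] averages [g (y * x)] over [y]; with a weight at least [c0] the
   point [y * x] is close to a minimum of [g], whatever [x] is. *)
Lemma convolve_contraction (eta e : R) : 0 < eta ->
  exists c0, [/\ 0 < c0, c0 <= 1 & forall g D, continuous g ->
    equicontinuous_by eta e g -> 0 <= D -> oscillation_le g (e + D) ->
    oscillation_le (convolve g) (e + (1 - c0) * D)].
Proof.
move=> eta0; have eta2 : 0 < eta / 2 by rewrite divr_gt0.
have [s [lam hp]] := partition_of_unity_exists rhoP cY eta2.
have [c0 [c00 c01 hc0]] := pou_mean_lower_bound hp.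
exists c0; split => // g D cg Kg D0 og x x'.
have [z _ zmin] : exists2 z, z \in [set: Y] & forall t, t \in [set: Y] -> g z <= g t.
  apply: compact_EVT_min => //; first by exists 1%g.
  exact: continuous_subspaceT.
have zle y : g z <= g y by apply: zmin; rewrite inE.
have lower : g z <= convolve g x'.
  rewrite -[leLHS](mean_cst hL); apply: (mean_le hL) => //.
    by move=> y; exact: cvg_cst.
  exact: continuous_translater.
(* At [y = w] the product [y * x] is the minimum point [z]. A bump positive at [w] lives within
   [eta] of [w], as both radii to its centre are below [eta / 2]. *)
set w := (z * x^-1)%g.
have [c cs lcw] : exists2 c, c \in s & 0 < lam c w.
  apply: contrapT => hn.
  have : \sum_(c <- s) lam c w = 0.
    rewrite big_seq; apply: big1 => c cs; apply/eqP; rewrite eq_le (pou_ge0 hp) andbT.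
    by rewrite leNgt; apply/negP => h; apply: hn; exists c.
  by rewrite (pou_sum hp) => /eqP; rewrite oner_eq0.
have cw : rho c w < eta / 2.
  by rewrite ltNge; apply/negP => h; move: lcw; rewrite (pou_supp hp h) ltxx.
have Lc : c0 <= L (lam c) by apply: hc0 => //; exists w.
(* The integrand is at most [g z + e + D - D * lam c y]: off the support of the bump by the
   oscillation bound, on it by the modulus and [lam c y <= 1]. Only the excess [D] over [e] is
   contracted. *)
have upper : convolve g x <= (g z + e + D) + (- D) * L (lam c).
  have clam := pou_continuous hp (c := c).
  rewrite -(meanZ hL) // -[X in _ <= X + _](mean_cst hL) -(meanD hL) //; first last.
  - exact: continuous_scale.
  - by move=> y; exact: cvg_cst.
  apply: (mean_le hL).
  - exact: continuous_translater.
  - move=> y; apply: cvgD; first exact: cvg_cst.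
    exact: continuous_scale.
  move=> y; have [hy|hy] := leP (eta / 2) (rho c y).
    rewrite (pou_supp hp hy) mulr0 addr0.
    by have := og (y * x)%g z; lra.
  have yw : rho y w < eta.
    have := cmetric_triangle rhoP c y w; rewrite (cmetric_sym rhoP y c); lra.
  have := Kg 1%g x y w yw; rewrite !mul1g /w mulgKV => hK.
  have l1 : lam c y <= 1 by apply: pou_le1 hp _ _ cs.
  have : D * lam c y <= D by rewrite -[leRHS]mulr1; apply: ler_wpM2l.
  by move: hK; rewrite ler_norml => /andP[_]; lra.
have : D * c0 <= D * L (lam c) by apply: ler_wpM2l.
lra.
Qed.

Variable H : (Y -> R) -> R.
Hypotheses (hH : is_mean H) (iH : left_invariant H).

(** After Fubini the invariance of [H] removes the translation: an invariant mean is fixed by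
    convolution with any mean. *)
Lemma mean_convolve f : continuous f -> H (convolve f) = H f.
Proof.
move=> cf; rewrite /convolve (mean_fubini rhoP cY cY hL hH (continuous_mul2 cf)) /=.
by under eq_fun do rewrite iH //; exact: (mean_cst hL).
Qed.

(** The iterates all have mean [H f] under [H], while their oscillation falls geometrically to
    [e / 2]; so their values are eventually within [e] of [H f]. *)
Lemma iter_convolve_cvg f (e : R) : continuous f -> 0 < e ->
  \forall n \near \oo, `|iter n convolve f 1%g - H f| <= e.
Proof.
move=> cf e0; have e2 : 0 < e / 2 by rewrite divr_gt0.
have [eta eta0 hf] := equicontinuous_by_exists cf e2.
have [c0 [c00 c01 hc]] := convolve_contraction (e / 2) eta0.
have [M M0 hM] := continuous_bounded cY cf.
have D0 : 0 <= 2 * M by rewrite mulr_ge0 // ltW.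
have key n : equicontinuous_by eta (e / 2) (iter n convolve f) /\
    oscillation_le (iter n convolve f) (e / 2 + (1 - c0) ^+ n * (2 * M)).
  elim: n => [|n [h1 h2]] /=; split => //.
  - move=> x x'; have := hM x; have := hM x'; rewrite !ler_norml expr0.
    move=> /andP[? ?] /andP[? ?]; lra.
  - by apply: equicontinuous_by_convolve => //; exact: iter_convolve_continuous.
  - rewrite exprS -mulrA; apply: hc => //; first exact: iter_convolve_continuous.
    by rewrite mulr_ge0 // exprn_ge0 // subr_ge0.
have : (1 - c0) ^+ n * (2 * M) @[n --> \oo] --> 0 * (2 * M).
  apply: cvgM; last exact: cvg_cst.
  by apply: cvg_expr; rewrite ger0_norm ?subr_ge0 //; lra.
rewrite mul0r => /cvgrPdist_le /(_ _ e2); apply: filterS => n.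
rewrite sub0r normrN => hn; have [_ osc] := key n.
have -> : H f = H (iter n convolve f).
  elim: n {hn osc} => //= n ->; rewrite mean_convolve //.
  exact: iter_convolve_continuous.
rewrite -[X in X - _](mean_cst hH); apply: (mean_close hH).
- by move=> y; exact: cvg_cst.
- exact: iter_convolve_continuous.
move=> y; have := osc 1%g y; have := osc y 1%g.
move: hn; rewrite !ler_norml => /andP[? ?] ? ?.
by apply/andP; split; lra.
Qed.

End KawadaIto.

(** * Finitely supported laws and averages over indices *)

Section Laws.
Context {R : realType}.

(* A law is a finitely supported measure, given as a list of weighted points. *)
Definition expect (T : Type) (s : seq (R * T)) (F : T -> R) : R :=
  \sum_(x <- s) x.1 * F x.2.

Definition is_law (T : Type) (s : seq (R * T)) : Prop :=
  all (fun x => 0 <= x.1) s /\ expect s (fun=> 1) = 1.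

Definition law_map (T U : Type) (h : T -> U) (s : seq (R * T)) : seq (R * U) :=
  [seq (x.1, h x.2) | x <- s].

Definition law_prod (T U : Type) (s : seq (R * T)) (t : seq (R * U)) :
    seq (R * (T * U)) :=
  [seq (x.1 * y.1, (x.2, y.2)) | x <- s, y <- t].

Section ExpectTheory.
Context {T : Type}.
Implicit Types (s : seq (R * T)) (F G : T -> R).

Lemma expectD s F G : expect s (fun t => F t + G t) = expect s F + expect s G.
Proof. by rewrite /expect -big_split /=; apply: eq_bigr => x _; rewrite mulrDr. Qed.

Lemma expectZ s a F : expect s (fun t => a * F t) = a * expect s F.
Proof. by rewrite /expect mulr_sumr; apply: eq_bigr => x _; rewrite mulrCA. Qed.

Lemma expect_sum s (I : Type) (r : seq I) (F : I -> T -> R) :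
  expect s (fun t => \sum_(i <- r) F i t) = \sum_(i <- r) expect s (F i).
Proof.
by rewrite /expect exchange_big /=; apply: eq_bigr => x _; rewrite mulr_sumr.
Qed.

Lemma expect_cst s a : is_law s -> expect s (fun=> a) = a.
Proof.
case=> _ s1; rewrite -[RHS]mulr1 -[in RHS]s1 -expectZ.
by under [in RHS]eq_fun do rewrite mulr1.
Qed.

Lemma expect_ge0 s F : is_law s -> (forall t, 0 <= F t) -> 0 <= expect s F.
Proof.
case=> + _ F0; rewrite /expect; elim: s => [|x s IH] /=; first by rewrite big_nil.
by rewrite big_cons => /andP[x0 /IH]; apply: addr_ge0; exact: mulr_ge0.
Qed.

Lemma expect_le s F G : is_law s -> (forall t, F t <= G t) -> expect s F <= expect s G.
Proof.
move=> ls FG; rewrite -subr_ge0 -mulN1r -expectZ -expectD.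
by apply: expect_ge0 => // t; rewrite mulN1r subr_ge0.
Qed.

Lemma expect_map (U : Type) (h : T -> U) s (F : U -> R) :
  expect (law_map h s) F = expect s (F \o h).
Proof. by rewrite /expect big_map. Qed.

Lemma expect_prod (U : Type) s (t : seq (R * U)) (F : T * U -> R) :
  expect (law_prod s t) F = expect s (fun x => expect t (fun y => F (x, y))).
Proof.
rewrite /expect /law_prod big_allpairs_dep; apply: eq_bigr => x _ /=.
by rewrite mulr_sumr; apply: eq_bigr => y _; rewrite mulrA.
Qed.

Lemma expect_exchange (U : Type) s (t : seq (R * U)) (F : T -> U -> R) :
  expect s (fun x => expect t (F x)) = expect t (fun y => expect s (F ^~ y)).
Proof.
rewrite /expect; under eq_bigr do rewrite mulr_sumr.
rewrite exchange_big; apply: eq_bigr => y _ /=; rewrite mulr_sumr.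
by apply: eq_bigr => x _; rewrite mulrCA.
Qed.

Lemma is_law_map (U : Type) (h : T -> U) s : is_law s -> is_law (law_map h s).
Proof.
by move=> [s0 s1]; split; [rewrite all_map|rewrite expect_map].
Qed.

Lemma is_law_dirac (t : T) : is_law [:: (1, t)].
Proof.
by split; [rewrite /= ler01|rewrite /expect big_seq1 mul1r].
Qed.

End ExpectTheory.

Lemma is_law_prod (T U : Type) (s : seq (R * T)) (t : seq (R * U)) :
  is_law s -> is_law t -> is_law (law_prod s t).
Proof.
move=> hs ht; split; last first.
  rewrite expect_prod; under eq_fun do rewrite expect_cst //.
  exact: expect_cst.
case: hs ht => + _ [+ _]; rewrite /law_prod => hs ht.
elim: s hs => //= x s IH /andP[x0 /IH {}IH]; rewrite all_cat IH andbT all_map.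
by apply: sub_all ht => y /=; exact: mulr_ge0.
Qed.

Section Average.
Context {n : nat}.
Implicit Types v w : 'I_n -> R.

Definition avg v : R := n%:R^-1 * \sum_j v j.

Lemma avgD v w : avg (fun j => v j + w j) = avg v + avg w.
Proof. by rewrite /avg big_split /= mulrDr. Qed.

Lemma avgZ a v : avg (fun j => a * v j) = a * avg v.
Proof. by rewrite /avg -mulr_sumr mulrCA. Qed.

Lemma avg_sum (I : Type) (r : seq I) (v : I -> 'I_n -> R) :
  avg (fun j => \sum_(i <- r) v i j) = \sum_(i <- r) avg (v i).
Proof. by rewrite /avg exchange_big /= mulr_sumr. Qed.

Lemma avg_le v w : (forall j, v j <= w j) -> avg v <= avg w.
Proof.
by move=> h; apply: ler_wpM2l; [rewrite invr_ge0|exact: ler_sum].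
Qed.

Lemma avg_ge0 v : (forall j, 0 <= v j) -> 0 <= avg v.
Proof.
move=> h; apply: mulr_ge0; first by rewrite invr_ge0.
by apply: sumr_ge0 => j _; exact: h.
Qed.

Lemma avg_cst a : (0 < n)%N -> avg (fun=> a) = a.
Proof.
move=> n0; rewrite /avg sumr_const card_ord -[a *+ n]mulr_natl mulrA mulVf ?mul1r //.
by rewrite pnatr_eq0 -lt0n.
Qed.

(** Includes [n = 0], where the average is [0] by the convention on inverses; upper bounds thus need
    no positivity of [n]. *)
Lemma avg_cst_le a : 0 <= a -> avg (fun=> a) <= a.
Proof.
move=> a0; have [n0|n0] := posnP n; last by rewrite avg_cst.
by rewrite /avg (_ : n%:R = 0) ?n0 // invr0 mul0r.
Qed.

Lemma norm_avg_le v : `|avg v| <= avg (fun j => `|v j|).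
Proof.
rewrite /avg normrM ger0_norm ?invr_ge0 //.
by apply: ler_wpM2l; [rewrite invr_ge0|exact: ler_norm_sum].
Qed.

Lemma norm_avg_bound v a : 0 <= a -> (forall j, `|v j| <= a) -> `|avg v| <= a.
Proof.
move=> a0 h; apply: (le_trans (norm_avg_le v)).
by apply: le_trans (avg_cst_le a0); exact: avg_le.
Qed.

Lemma avg_expect (T : Type) (s : seq (R * T)) (F : T -> 'I_n -> R) :
  avg (fun j => expect s (F ^~ j)) = expect s (fun t => avg (F t)).
Proof. by rewrite /avg -expect_sum -expectZ. Qed.

(** Cauchy-Schwarz without division: expand the nonnegative average of [(v - m * w) ^+ 2] for [m]
    the average of [v * w]. *)
Lemma sqr_avg_le v w : (forall j, `|w j| <= 1) ->
  avg (fun j => v j * w j) ^+ 2 <= avg (fun j => v j ^+ 2).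
Proof.
move=> hw; set m := avg _.
have : 0 <= avg (fun j => (v j - m * w j) ^+ 2) by apply: avg_ge0 => j; exact: sqr_ge0.
have -> : avg (fun j => (v j - m * w j) ^+ 2) =
    avg (fun j => v j ^+ 2) - 2 * m ^+ 2 + m ^+ 2 * avg (fun j => w j ^+ 2).
  transitivity (avg (fun j => v j ^+ 2 + ((- 2 * m) * (v j * w j) + m ^+ 2 * w j ^+ 2))).
    by congr avg; apply/funext => j; ring.
  by rewrite !avgD !avgZ -/m; ring.
have : avg (fun j => w j ^+ 2) <= 1.
  apply: le_trans (avg_cst_le ler01); apply: avg_le => j.
  by rewrite -real_normK ?num_real // expr_le1.
move=> h1 h2; have : m ^+ 2 * avg (fun j => w j ^+ 2) <= m ^+ 2 * 1.
  by apply: ler_wpM2l => //; exact: sqr_ge0.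
lra.
Qed.

End Average.
End Laws.

(** * Concentration of random maps and pairs of independent samples *)

Section Concentration.
Context {R : realType} {d : nat -> nat}.

Definition random_maps (T : Type) := forall k, seq (R * ('I_(d k) -> T)).

(* Taking for [w] the signs of [E f(phi j) - L f] gives the convergence of the
   marginals, and taking for [w] another sample gives the double convergence. *)
Definition concentrates (T : topologicalType) (s : random_maps T)
    (L : (T -> R) -> R) : Prop :=
  forall (f : T -> R) (e : R), continuous f -> 0 < e ->
  \forall k \near \oo, forall w : 'I_(d k) -> R, (forall j, `|w j| <= 1) ->
    expect (s k) (fun phi => `|avg (fun j => (f (phi j) - L f) * w j)|) <= e.

Lemma near_forall_seq (I : choiceType) (r : seq I) (P : I -> nat -> Prop) :
  (forall i, \forall k \near \oo, P i k) ->
  \forall k \near \oo, forall i, i \in r -> P i k.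
Proof.
move=> h; elim: r => [|i r IH]; first by near=> k.
near=> k => j; rewrite inE => /orP[/eqP ->|]; first by near: k; exact: h.
by move: j; near: k.
Unshelve. all: by end_near. Qed.

Section Tensor.
Context {T : ptopologicalType} {B : topologicalType} {rho : T -> T -> R}.
Variables (L : (T -> R) -> R) (H : (B -> R) -> R).
Hypotheses (rhoP : compatible_metric rho) (cT : compact [set: T])
  (cB : compact [set: B]) (hL : is_mean L) (hH : is_mean H).
Variables (s : random_maps T) (t : random_maps B).
Hypotheses (hs : forall k, is_law (s k)) (ht : forall k, is_law (t k))
  (cs : concentrates s L) (ct : concentrates t H).

(** With [S] the separated sum and [l'] its double mean, [F - l] splits into the errors [F - S] and
    [l' - l], and the main part [S - l']. There [lam c (a j)] is replaced by its mean with
    [F (c, b j)] moved into the weight, which leaves a sum in [b] alone. *)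
Lemma avg_tensor_decomposition n (F : T * B -> R) (e : R) (r : seq T)
    (lam : T -> T -> R) (l : R) (w : 'I_n -> R) (a : 'I_n -> T) (b : 'I_n -> B) :
  0 <= e -> (forall j, `|w j| <= 1) ->
  (forall a b, `|F (a, b) - \sum_(c <- r) lam c a * F (c, b)| <= e) ->
  `|l - \sum_(c <- r) L (lam c) * H (fun b => F (c, b))| <= e ->
  (forall c, 0 <= L (lam c)) ->
  `|avg (fun j => (F (a j, b j) - l) * w j)| <=
    (e + e)
    + (\sum_(c <- r) `|avg (fun j => (lam c (a j) - L (lam c)) * (F (c, b j) * w j))|
    + \sum_(c <- r) L (lam c) *
        `|avg (fun j => (F (c, b j) - H (fun b => F (c, b))) * w j)|).
Proof.
move=> e0 hw h1 h2 L0.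
pose S a b := \sum_(c <- r) lam c a * F (c, b).
pose l' := \sum_(c <- r) L (lam c) * H (fun b => F (c, b)).
have -> : avg (fun j => (F (a j, b j) - l) * w j) =
    avg (fun j => (F (a j, b j) - S (a j) (b j)) * w j) +
    avg (fun j => (l' - l) * w j) +
    (\sum_(c <- r) avg (fun j => (lam c (a j) - L (lam c)) * (F (c, b j) * w j)) +
     \sum_(c <- r) L (lam c) * avg (fun j => (F (c, b j) - H (fun b => F (c, b))) * w j)).
  under [X in _ + (_ + X)]eq_bigr do rewrite -avgZ.
  rewrite -!avg_sum -!avgD; congr avg; apply/funext => j.
  have -> : \sum_(i <- r) (lam i (a j) - L (lam i)) * (F (i, b j) * w j) +
      \sum_(i <- r) L (lam i) * ((F (i, b j) - H (fun b => F (i, b))) * w j) =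
      (S (a j) (b j) - l') * w j.
    rewrite -big_split /= /S /l' -sumrB mulr_suml; apply: eq_bigr => i _; ring.
  ring.
apply: (le_trans (ler_normD _ _)); apply: lerD.
  apply: (le_trans (ler_normD _ _)); apply: lerD; apply: norm_avg_bound => // j;
    rewrite normrM -[leRHS]mulr1; apply: ler_pM => //.
  by rewrite distrC.
apply: (le_trans (ler_normD _ _)); apply: lerD; rewrite (le_trans (ler_norm_sum _ _ _)) //.
by apply: ler_sum => c _; rewrite normrM (ger0_norm (L0 c)).
Qed.

(** For a frozen [b] the numbers [M^-1 * (F (c, b j) * w j)] form an admissible weight, so
    concentration of [s] applies with a bound independent of [b]. This is where uniformity in [w] is
    indispensable. *)
Lemma concentrates_tensor (F : T * B -> R) (e : R) : continuous F -> 0 < e ->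
  \forall k \near \oo, forall w : 'I_(d k) -> R, (forall j, `|w j| <= 1) ->
    expect (s k) (fun a => expect (t k) (fun b =>
      `|avg (fun j => (F (a j, b j) - H (fun b => L (fun a => F (a, b)))) * w j)|)) <= e.
Proof.
move=> cF e0; have [c1 c2] := continuous_section cF.
have e3 : 0 < e / 3 by rewrite divr_gt0.
have [eta eta0 hF] := uniform_close rhoP cB cF e3.
have [r [lam hp]] := partition_of_unity_exists rhoP cT eta0.
have cTB : compact [set: T * B] by rewrite -setXTT; exact: compact_setX.
have [M M0 hM] := continuous_bounded cTB cF.
have Dgt0 : 0 < (size r)%:R * M + 1 :> R by rewrite ltr_wpDl // mulr_ge0 // ltW.
(* Each of the [size r] terms in [a] costs [M * tau]; the terms in [b] cost [tau] together, their
   coefficients adding up to 1. The total is [e / 3]. *)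
pose tau := e / 3 / ((size r)%:R * M + 1).
have tau0 : 0 < tau by rewrite divr_gt0.
have L0 c : 0 <= L (lam c).
  rewrite -[leLHS](mean_cst hL); apply: (mean_le hL).
  - by move=> x; exact: cvg_cst.
  - exact: (pou_continuous hp).
  - exact: (pou_ge0 hp).
have Lsum : \sum_(c <- r) L (lam c) = 1.
  have := mean_sum hL r (fun=> 1) (pou_continuous hp).
  under eq_fun do under eq_bigr do rewrite mul1r.
  under eq_fun do rewrite (pou_sum hp).
  rewrite (mean1 hL) => E; rewrite [RHS]E.
  by apply: eq_bigr => c _; rewrite mul1r.
near=> k => w hw.
have hsk : forall c, c \in r -> forall w : 'I_(d k) -> R, (forall j, `|w j| <= 1) ->
    expect (s k) (fun a => `|avg (fun j => (lam c (a j) - L (lam c)) * w j)|) <= tau.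
  near: k; apply: near_forall_seq => c; apply: cs => //; exact: (pou_continuous hp).
have htk : forall c, c \in r -> forall w : 'I_(d k) -> R, (forall j, `|w j| <= 1) ->
    expect (t k) (fun b => `|avg (fun j =>
      (F (c, b j) - H (fun b => F (c, b))) * w j)|) <= tau.
  by near: k; apply: near_forall_seq => c; exact: ct.
set l := H _.
pose X c (a : 'I_(d k) -> T) (b : 'I_(d k) -> B) :=
  `|avg (fun j => (lam c (a j) - L (lam c)) * (F (c, b j) * w j))|.
pose Y c (b : 'I_(d k) -> B) :=
  `|avg (fun j => (F (c, b j) - H (fun b => F (c, b))) * w j)|.
apply: (@le_trans _ _ (expect (s k) (fun a => expect (t k) (fun b =>
    (e / 3 + e / 3) + (\sum_(c <- r) X c a b + \sum_(c <- r) L (lam c) * Y c b))))).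
  apply: expect_le => // a; apply: expect_le => // b.
  apply: avg_tensor_decomposition => //; first exact: ltW.
    exact: tensor_approx hp hF.
  exact: mean_tensor_approx hF.
have -> : expect (s k) (fun a => expect (t k) (fun b =>
    (e / 3 + e / 3) + (\sum_(c <- r) X c a b + \sum_(c <- r) L (lam c) * Y c b))) =
    (e / 3 + e / 3) + (\sum_(c <- r) expect (t k) (fun b => expect (s k) (X c ^~ b))
     + \sum_(c <- r) L (lam c) * expect (t k) (Y c)).
  under eq_fun do rewrite !expectD expect_cst // !expect_sum.
  rewrite !expectD expect_cst // !expect_sum; congr (_ + (_ + _)).
    by apply: eq_bigr => c _; exact: expect_exchange.
  by apply: eq_bigr => c _; rewrite expect_cst // expectZ.
have hX : \sum_(c <- r) expect (t k) (fun b => expect (s k) (X c ^~ b)) <=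
    (size r)%:R * M * tau.
  have -> : (size r)%:R * M * tau = \sum_(c <- r) M * tau.
    by rewrite big_const_seq count_predT iter_addr addr0 -[RHS]mulr_natl mulrA.
  rewrite big_seq [leRHS]big_seq.
  apply: ler_sum => c cr.
  rewrite -[leRHS](expect_cst _ (ht k)); apply: expect_le => // b.
  have -> : X c ^~ b = fun a => M * `|avg (fun j =>
      (lam c (a j) - L (lam c)) * (M^-1 * (F (c, b j) * w j)))|.
    apply/funext => a; rewrite /X -[X in X * `|_|]gtr0_norm // -normrM -avgZ.
    congr `|avg _|; apply/funext => j; field; exact: lt0r_neq0.
  rewrite expectZ; apply: ler_wpM2l; first exact: ltW.
  apply: hsk => // j; rewrite normrM gtr0_norm ?invr_gt0 //.
  rewrite ler_pdivrMl // mulr1 normrM -[leRHS]mulr1; exact: ler_pM.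
have hY : \sum_(c <- r) L (lam c) * expect (t k) (Y c) <= tau.
  rewrite -[leRHS]mul1r -Lsum mulr_suml big_seq [leRHS]big_seq.
  by apply: ler_sum => c cr; apply: ler_wpM2l => //; exact: htk.
have : (size r)%:R * M * tau + tau = e / 3 by rewrite /tau; field; exact: lt0r_neq0.
lra.
Unshelve. all: by end_near. Qed.

End Tensor.
End Concentration.

(** * Asymptotic equivariance and images under factor maps *)

Section Equivariance.
Context {R : realType} {d : nat -> nat} {G : groupType}.
Variable sigma : forall k, G -> 'S_(d k).

(** The mean proportion of bad indices replaces the probability that this proportion is large. The
    two are equivalent by Markov, and means simply add up when samples are multiplied. *)
Definition asymptotically_equivariant (T : Type) (rho : T -> T -> R)
    (act : G -> T -> T) (s : @random_maps R d T) : Prop :=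
  forall (g : G) (eta e : R), 0 < eta -> 0 < e -> \forall k \near \oo,
    expect (s k) (fun phi => avg (fun j =>
      (eta <= rho (phi (sigma k g j)) (act g (phi j)))%R%:R)) <= e.

Definition push (T U : Type) (h : T -> U) (s : @random_maps R d T) :
    @random_maps R d U :=
  fun k => law_map (fun phi => h \o phi) (s k).

Lemma concentrates_push (T U : topologicalType) (h : T -> U)
    (s : @random_maps R d T) (L : (T -> R) -> R) : continuous h ->
  concentrates s L -> concentrates (push h s) (fun f => L (f \o h)).
Proof.
move=> ch cs f e cf e0.
have cfh : continuous (f \o h) by move=> x; apply: continuous_comp; [exact: ch|exact: cf].
have := cs (f \o h) e cfh e0.
by apply: filterS => k hk w hw; rewrite expect_map; exact: hk.
Qed.

Lemma compatible_uniform_continuous (T : ptopologicalType) (U : topologicalType)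
    (rhoT : T -> T -> R) (rhoU : U -> U -> R) (h : T -> U) (e : R) :
  compact [set: T] -> compatible_metric rhoT -> compatible_metric rhoU ->
  continuous h -> 0 < e ->
  exists2 eta, 0 < eta & forall x y, rhoT x y < eta -> rhoU (h x) (h y) < e.
Proof.
move=> cT hT hU ch e0; have e2 : 0 < e / 2 by rewrite divr_gt0.
have cF : continuous (fun q : T * T => rhoU (h q.1) (h q.2)).
  move=> q; apply: (@continuous_comp _ _ _ (fun q : T * T => (h q.1, h q.2))
     (fun q => rhoU q.1 q.2)); last exact: cmetric_continuous.
  by apply: cvg_pair; apply: continuous_comp;
    [exact: cvg_fst|exact: ch|exact: cvg_snd|exact: ch].
have [eta eta0 h1] := uniform_close hT cT cF e2.
exists eta => // x y /h1 /(_ y) /=; rewrite (cmetric_xx hU) subr0 => h2.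
by have := ler_norm (rhoU (h x) (h y)); lra.
Qed.

Lemma asymptotically_equivariant_push (T : ptopologicalType) (U : topologicalType)
    (rhoT : T -> T -> R) (rhoU : U -> U -> R) (actT : G -> T -> T)
    (actU : G -> U -> U) (h : T -> U) (s : @random_maps R d T) :
  compact [set: T] -> compatible_metric rhoT -> compatible_metric rhoU ->
  continuous h -> (forall g x, h (actT g x) = actU g (h x)) ->
  (forall k, is_law (s k)) -> asymptotically_equivariant rhoT actT s ->
  asymptotically_equivariant rhoU actU (push h s).
Proof.
move=> cT hT hU ch eh ls hs g eta e eta0 e0.
have [eta' eta'0 h1] := compatible_uniform_continuous cT hT hU ch eta0.
have := hs g eta' e eta'0 e0; apply: filterS => k; apply: le_trans.
rewrite expect_map; apply: expect_le => // phi; apply: avg_le => j /=.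
rewrite ler_nat -eh; case: (leP eta') => [_|/h1]; first by case: (_ <= _).
by rewrite ltNge => /negbTE ->.
Qed.

End Equivariance.

(** * Pointwise products of independent samples *)

Section ConvolutionPowers.
Context {R : realType} {d : nat -> nat} {G : groupType}
  {Y : topologicalGroupType} {rho : Y -> Y -> R} {act : G -> Y -> Y}.
Variable sigma : forall k, G -> 'S_(d k).
Hypotheses (cY : compact [set: Y]) (rhoP : compatible_metric rho)
  (actM : forall g x y, act g (x * y)%g = (act g x * act g y)%g).
Variables (L : (Y -> R) -> R) (s : @random_maps R d Y).
Hypotheses (hL : is_mean L) (ls : forall k, is_law (s k)) (cs : concentrates s L).

Fixpoint conv_power (n : nat) : @random_maps R d Y := fun k =>
  if n is n'.+1 then
    law_map (fun q j => (q.1 j * q.2 j)%g) (law_prod (s k) (conv_power n' k))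
  else [:: (1, fun=> 1%g)].

Lemma is_law_conv_power n k : is_law (conv_power n k).
Proof.
elim: n => [|n IH] /=; first exact: is_law_dirac.
by apply: is_law_map; exact: is_law_prod.
Qed.

Lemma concentrates_conv_power n :
  concentrates (conv_power n) (fun f => iter n (convolve L) f 1%g).
Proof.
elim: n => [|n IH] f e cf e0.
  near=> k => w hw; rewrite /= /expect big_seq1 mul1r /=.
  have -> : avg (fun j : 'I_(d k) => (f 1%g - f 1%g) * w j) = 0.
    by rewrite /avg big1 ?mulr0 // => j _; rewrite subrr mul0r.
  by rewrite normr0 ltW.
have := concentrates_tensor rhoP cY cY hL (iter_convolve_is_mean cY hL n)
  ls (is_law_conv_power n) cs IH (continuous_mul2 cf) e0.
apply: filterS => k hk w hw; rewrite /= expect_map expect_prod.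
(* The limit for the pair is [iter n (convolve L)] applied to [convolve L f], with the new factor
   innermost. *)
by rewrite -iterS iterSr; exact: hk.
Unshelve. all: by end_near. Qed.

Lemma mul_uniform_continuous (e : R) : 0 < e -> exists2 eta, 0 < eta &
  forall a a' b b', rho a a' < eta -> rho b b' < eta ->
    rho (a * b)%g (a' * b')%g < e.
Proof.
move=> e0; have e3 : 0 < e / 3 by rewrite divr_gt0.
have cYY : compact [set: Y * Y] by rewrite -setXTT; exact: compact_setX.
have c1 (A : topologicalType) (u v : A -> Y) : continuous u -> continuous v ->
    continuous (fun q => rho (u q) (v q)).
  move=> cu cv q; apply: (@continuous_comp _ _ _ (fun q => (u q, v q))
    (fun q => rho q.1 q.2)); last exact: cmetric_continuous.
  by apply: cvg_pair; [exact: cu|exact: cv].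
have p1 : continuous (fun q : Y * (Y * Y) => q.1) by move=> q; exact: cvg_fst.
have p2 : continuous (fun q : Y * (Y * Y) => q.2.1).
  by move=> q; apply: (@cvg_comp _ _ _ snd fst); [exact: cvg_snd|exact: cvg_fst].
have p3 : continuous (fun q : Y * (Y * Y) => q.2.2).
  by move=> q; apply: (@cvg_comp _ _ _ snd snd); [exact: cvg_snd|exact: cvg_snd].
(* One factor moves at a time. The pair [q.2] holds the target of the moving factor [q.1] and the
   fixed factor; the function vanishes when [q.1] reaches its target, so [uniform_close] bounds the
   distance itself. *)
have cF1 : continuous (fun q : Y * (Y * Y) => rho (q.1 * q.2.2)%g (q.2.1 * q.2.2)%g).
  by apply: c1 => q; [exact: (mulg_cvg (p1 q) (p3 q))|exact: (mulg_cvg (p2 q) (p3 q))].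
have cF2 : continuous (fun q : Y * (Y * Y) => rho (q.2.1 * q.1)%g (q.2.1 * q.2.2)%g).
  by apply: c1 => q; [exact: (mulg_cvg (p2 q) (p1 q))|exact: (mulg_cvg (p2 q) (p3 q))].
have [eta1 eta10 h1] := uniform_close rhoP cYY cF1 e3.
have [eta2 eta20 h2] := uniform_close rhoP cYY cF2 e3.
exists (Num.min eta1 eta2); first by rewrite lt_min eta10.
move=> a a' b b'; rewrite !lt_min => /andP[+ _] /andP[_ +].
move=> /h1 /(_ (a', b)) /= {}h1 /h2 /(_ (a', b')) /= {}h2.
move: h1 h2; rewrite !(cmetric_xx rhoP) !subr0 => h1 h2.
have := cmetric_triangle rhoP (a' * b)%g (a * b)%g (a' * b')%g.
have := ler_norm (rho (a * b)%g (a' * b)%g).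
by have := ler_norm (rho (a' * b)%g (a' * b')%g); lra.
Qed.

Hypothesis es : asymptotically_equivariant sigma rho act s.

(** Since [act g] distributes over products, an index bad for the product at scale [eta] is bad for
    one of the two factors at scale [eta'], and the proportions add up. *)
Lemma asymptotically_equivariant_conv_power n :
  asymptotically_equivariant sigma rho act (conv_power n).
Proof.
have act1 g : act g 1%g = 1%g.
  by apply: (@mulgI _ (act g 1%g)); rewrite -actM !mulg1.
elim: n => [|n IH] g eta e eta0 e0.
  near=> k; rewrite /= /expect big_seq1 mul1r /= act1 (cmetric_xx rhoP).
  have -> : (eta <= 0) = false by rewrite leNgt eta0.
  apply: le_trans (ltW e0); exact: avg_cst_le.
have [eta' eta'0 h] := mul_uniform_continuous eta0.
have e2 : 0 < e / 2 by rewrite divr_gt0.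
have := IH g eta' _ eta'0 e2; apply: filterS2 (es g eta'0 e2) => k h1 h2.
rewrite /= expect_map expect_prod.
pose X (phi : 'I_(d k) -> Y) :=
  avg (fun j => (eta' <= rho (phi (sigma k g j)) (act g (phi j)))%R%:R : R).
apply: (@le_trans _ _ (expect (s k) (fun a => expect (conv_power n k)
    (fun b => X a + X b)))).
  apply: expect_le => // a; apply: expect_le; first exact: is_law_conv_power.
  move=> b /=; rewrite /X -avgD; apply: avg_le => j; rewrite -natrD ler_nat actM.
  have [_|ha] := leP eta' (rho (a _) _); first by case: (eta <= _).
  have [_|hb] := leP eta' (rho (b _) _); first by case: (eta <= _).
  by rewrite leNgt h.
under eq_fun do rewrite expectD (expect_cst _ (is_law_conv_power n k)).
rewrite expectD (expect_cst _ (ls k)).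
move: h1 h2; rewrite -/X; lra.
Unshelve. all: by end_near. Qed.

End ConvolutionPowers.

(** * Diagonal argument and sampling of the Haar measure *)

Lemma diagonal_sequence (Q : nat -> nat -> nat -> Prop) :
  (forall m, \forall n \near \oo, \forall k \near \oo, Q m n k) ->
  exists n_ : nat -> nat, forall m, \forall k \near \oo, Q m (n_ k) k.
Proof.
move=> hQ.
have hN m : exists N, forall n, (N <= n)%N -> \forall k \near \oo, Q m n k.
  by have [N _ hN] := hQ m; exists N => n Nn; exact: hN.
have [N {}hN] := choice hN.
have hall n : exists K, forall k, (K <= k)%N -> forall m, (m <= n)%N ->
    (N m <= n)%N -> Q m n k.
  have : \forall k \near \oo, forall m, m \in iota 0 n.+1 -> (N m <= n)%N -> Q m n k.
    apply: near_forall_seq => m; have [Nm|_] := leqP (N m) n; last by near=> k.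
    by have := hN m n Nm; apply: filterS.
  move=> [K _ hK]; exists K => k Kk m mn; apply: (hK k Kk).
  by rewrite mem_iota.
have [K hK] := choice hall.
(* From [K n] on, all [Q m n] with [m <= n] and [N m <= n] hold; [n_ k] is the largest [n <= k] past
   its rank. An empty maximum is [0], whence the proviso [K 0 <= k] in [n_K]. *)
pose n_ k := \max_(n < k.+1 | (K n <= k)%N) n.
have n_ge n k : (n <= k)%N -> (K n <= k)%N -> (n <= n_ k)%N.
  move=> nk Kn; rewrite -ltnS in nk.
  by rewrite /n_ (bigD1 (Ordinal nk)) //= leq_maxl.
have n_K k : (K 0 <= k)%N -> (K (n_ k) <= k)%N.
  move=> K0; rewrite /n_; elim/big_ind: _ => // x y Kx Ky.
  by rewrite /maxn; case: ifP.
exists n_ => m; pose p := maxn m (N m).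
exists (maxn (K 0) (maxn p (K p))) => // k /=.
rewrite !geq_max => /andP[K0 /andP[/andP[mk Nk] Km]].
have := n_ge p k; rewrite /p geq_max mk Nk => /(_ isT Km).
by rewrite geq_max => /andP[mn Nn]; apply: (hK (n_ k)) => //; exact: n_K.
Unshelve. all: by end_near. Qed.

Section HaarSampling.
Context {R : realType} {d : nat -> nat} {G : groupType}
  {Y : topologicalGroupType} {rho : Y -> Y -> R} {act : G -> Y -> Y}.
Variable sigma : forall k, G -> 'S_(d k).
Hypotheses (cY : compact [set: Y]) (rhoP : compatible_metric rho).

Section PartitionTest.
Variables (H : (Y -> R) -> R) (t : @random_maps R d Y)
  (r : nat -> seq Y) (lam : nat -> Y -> Y -> R).
Hypotheses (hH : is_mean H) (lt : forall k, is_law (t k))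
  (hp : forall m, partition_of_unity rho m.+1%:R^-1 (r m) (lam m)).

(** Concentration tested on the [m]-th partition only. The tolerance lets the errors over [r m] add
    up to at most [1/(m+1)]; the successor of the size keeps it positive. *)
Definition partition_test m k (u : seq (R * ('I_(d k) -> Y))) : Prop :=
  forall c, c \in r m -> forall w : 'I_(d k) -> R, (forall j, `|w j| <= 1) ->
    expect u (fun phi => `|avg (fun j => (lam m c (phi j) - H (lam m c)) * w j)|)
      <= ((size (r m)).+1%:R * m.+1%:R)^-1.

Lemma concentrates_partition_test :
  (forall m, \forall k \near \oo, partition_test m (t k)) -> concentrates t H.
Proof.
move=> ht f e cf e0.
have e3 : 0 < e / 3 by rewrite divr_gt0.
have [M M0 hM] := continuous_bounded cY cf.
(* A dummy second variable makes the two-variable approximation lemmas available for [f]. *)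
have cF : continuous (fun q : Y * Y => f q.1).
  by move=> q; apply: continuous_comp; [exact: cvg_fst|exact: cf].
have [eta eta0 hF] := uniform_close rhoP cY cF e3.
have eM : 0 < e / 3 / M by rewrite divr_gt0.
have [m [m1 m2]] : exists m, m.+1%:R^-1 < eta /\ m.+1%:R^-1 < e / 3 / M.
  have h : \forall m \near \oo, m.+1%:R^-1 < eta /\ m.+1%:R^-1 < e / 3 / M.
    near=> m; split; near: m.
      exact: (near_infty_natSinv_lt (PosNum eta0)).
    exact: (near_infty_natSinv_lt (PosNum eM)).
  by have [m] := filter_ex h; exists m.
have hf y : `|f y - \sum_(c <- r m) lam m c y * f c| <= e / 3.
  apply: (tensor_approx (F := fun q : Y * Y => f q.1) (hp m) _ y y).
  by move=> a a' aa' b; apply: hF => //; exact: lt_trans aa' m1.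
have cl := pou_continuous (hp m).
have hHf : `|H f - \sum_(c <- r m) f c * H (lam m c)| <= e / 3.
  rewrite -(mean_sum hH) //; apply: (mean_close hH) => //.
    by apply: continuous_sum => c; exact: continuous_scale.
  by move=> y; under [X in _ - X]eq_bigr do rewrite mulrC; exact: hf.
apply: filterS (ht m) => k hk w hw.
pose X c (phi : 'I_(d k) -> Y) :=
  `|avg (fun j => (lam m c (phi j) - H (lam m c)) * w j)|.
apply: (@le_trans _ _ (expect (t k) (fun phi =>
   (e / 3 + e / 3) + M * \sum_(c <- r m) X c phi))).
  apply: expect_le => // phi.
  have -> : avg (fun j => (f (phi j) - H f) * w j) =
      avg (fun j => (f (phi j) - \sum_(c <- r m) lam m c (phi j) * f c) * w j)
      + avg (fun j => (\sum_(c <- r m) f c * H (lam m c) - H f) * w j)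
      + \sum_(c <- r m) f c * avg (fun j => (lam m c (phi j) - H (lam m c)) * w j).
    under [X in _ + X]eq_bigr do rewrite -avgZ.
    rewrite -avg_sum -!avgD; congr avg; apply/funext => j.
    have -> : \sum_(c <- r m) f c * ((lam m c (phi j) - H (lam m c)) * w j) =
        (\sum_(c <- r m) lam m c (phi j) * f c - \sum_(c <- r m) f c * H (lam m c)) * w j.
      by rewrite -sumrB mulr_suml; apply: eq_bigr => c _; ring.
    ring.
  apply: (le_trans (ler_normD _ _)); apply: lerD.
    apply: (le_trans (ler_normD _ _)); apply: lerD; apply: norm_avg_bound => [|j];
      rewrite ?(ltW e3) // normrM -[leRHS]mulr1; apply: ler_pM => //.
    by rewrite distrC.
  rewrite (le_trans (ler_norm_sum _ _ _)) // mulr_sumr; apply: ler_sum => c _.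
  by rewrite normrM; apply: ler_wpM2r.
rewrite expectD expect_cst // expectZ expect_sum.
have : \sum_(c <- r m) expect (t k) (X c) <= m.+1%:R^-1.
  apply: (@le_trans _ _ (\sum_(c <- r m) ((size (r m)).+1%:R * m.+1%:R)^-1)).
    by rewrite big_seq [leRHS]big_seq; apply: ler_sum => c cr; exact: hk.
  rewrite big_const_seq count_predT iter_addr addr0 invfM -mulrnAl -[leRHS]mul1r.
  apply: ler_wpM2r; first by rewrite invr_ge0.
  by rewrite -[X in X *+ _]mul1r -mulrnAl ler_pdivrMr // mul1r ler_nat.
move=> /(ler_wpM2l (ltW M0)) h.
have : M * m.+1%:R^-1 < e / 3 by rewrite mulrC -ltr_pdivlMr.
move=> h'; apply: (le_trans (lerD (lexx _) h)).
by move: h'; set z := M * _; lra.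
Unshelve. all: by end_near. Qed.

End PartitionTest.

Hypotheses (G_countable : countable [set: G])
  (actM : forall g x y, act g (x * y)%g = (act g x * act g y)%g).

Lemma countable_enumeration : exists g_ : nat -> G, forall g, exists i, g_ i = g.
Proof.
have /countable_injP [f finj] := G_countable.
exists (fun i => xget 1%g [set g | f g = i]) => g; exists (f g).
case: xgetP => [h _ /= fh|/(_ g)] //=.
by apply: finj; rewrite ?inE.
Qed.

Variables (L H : (Y -> R) -> R) (s : @random_maps R d Y).
Hypotheses (hL : is_mean L) (Lpos : strictly_positive L)
  (hH : is_mean H) (iH : left_invariant H)
  (ls : forall k, is_law (s k)) (cs : concentrates s L)
  (es : asymptotically_equivariant sigma rho act s).

Lemma haar_sampling : exists t : @random_maps R d Y,
  [/\ forall k, is_law (t k), concentrates t H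
    & asymptotically_equivariant sigma rho act t].
Proof.
have [g_ hg] := countable_enumeration.
have pou m : exists rl : seq Y * (Y -> Y -> R),
    partition_of_unity rho m.+1%:R^-1 rl.1 rl.2.
  have m0 : 0 < m.+1%:R^-1 :> R by rewrite invr_gt0.
  by have [r [lam hr]] := partition_of_unity_exists rhoP cY m0; exists (r, lam).
have [rl hp] := choice pou.
pose r m := (rl m).1; pose lam m := (rl m).2.
pose p n := conv_power s n.
have lp n k : is_law (p n k) by exact: is_law_conv_power.
(* Stage [m] combines the [m]-th partition test with near equivariance, at scale and tolerance
   [1/(m+1)], under the first [m] enumerated elements. Each instance of concentration or
   equivariance follows from a single stage. *)
pose Q m n k : Prop := partition_test H r lam m (p n k) /\
  forall i, i \in iota 0 m -> expect (p n k) (fun phi => avg (fun j =>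
     (m.+1%:R^-1 <= rho (phi (sigma k (g_ i) j)) (act (g_ i) (phi j)))%R%:R))
   <= m.+1%:R^-1.
have hQ m : \forall n \near \oo, \forall k \near \oo, Q m n k.
  pose tol : R := ((size (r m)).+1%:R * m.+1%:R)^-1.
  have tol2 : 0 < tol / 2 by rewrite divr_gt0 // invr_gt0 mulr_gt0.
  have cl := pou_continuous (hp m).
  (* Half of the tolerance pays for the distance from the convolution power to the Haar mean, half
     for the sampling error once [n] is fixed. *)
  have : \forall n \near \oo, forall c, c \in r m ->
      `|iter n (convolve L) (lam m c) 1%g - H (lam m c)| <= tol / 2.
    apply: near_forall_seq => c.
    by apply: (iter_convolve_cvg cY rhoP hL Lpos hH iH) => //; exact: cl.
  apply: filterS => n hn.
  have m0 : 0 < m.+1%:R^-1 :> R by rewrite invr_gt0.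
  near=> k; split; last first.
    near: k; apply: near_forall_seq => i.
    exact: (asymptotically_equivariant_conv_power cY rhoP actM ls es).
  have hk : forall c, c \in r m -> forall w : 'I_(d k) -> R,
      (forall j, `|w j| <= 1) -> expect (p n k) (fun phi => `|avg (fun j =>
        (lam m c (phi j) - iter n (convolve L) (lam m c) 1%g) * w j)|) <= tol / 2.
    near: k; apply: near_forall_seq => c.
    by apply: (concentrates_conv_power cY rhoP hL ls cs) => //; exact: cl.
  move=> c cr w hw; rewrite -/tol [leRHS]splitr.
  apply: le_trans (lerD (hk c cr w hw) (hn c cr)).
  rewrite -[X in _ <= _ + X](expect_cst _ (lp n k)) -expectD.
  apply: expect_le => // phi.
  set l := iter _ _ _ _.
  have -> : avg (fun j => (lam m c (phi j) - H (lam m c)) * w j) =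
      avg (fun j => (lam m c (phi j) - l) * w j) + avg (fun j => (l - H (lam m c)) * w j).
    by rewrite -avgD; congr avg; apply/funext => j; ring.
  apply: (le_trans (ler_normD _ _)); apply: lerD => //.
  apply: norm_avg_bound => // j.
  by rewrite normrM -[leRHS]mulr1; apply: ler_pM.
have [n_ hn] := diagonal_sequence hQ.
exists (fun k => p (n_ k) k); split => //.
- apply: (concentrates_partition_test hH _ hp) => // m.
  by apply: filterS (hn m) => k [].
- move=> g eta e eta0 e0; have [i gi] := hg g.
  have [m [m1 m2 m3]] : exists m, [/\ m.+1%:R^-1 < eta, m.+1%:R^-1 < e & (i < m)%N].
    have h : \forall m \near \oo,
        [/\ m.+1%:R^-1 < eta, m.+1%:R^-1 < e & (i < m)%N].
      near=> m; split; near: m.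
      + exact: (near_infty_natSinv_lt (PosNum eta0)).
      + exact: (near_infty_natSinv_lt (PosNum e0)).
      + exact: nbhs_infty_gt.
    by have [m] := filter_ex h; exists m.
  apply: filterS (hn m) => k [_ /(_ i)]; rewrite mem_iota => /(_ m3) hk.
  apply: le_trans (ltW m2); apply: le_trans hk.
  apply: expect_le => // phi; apply: avg_le => j; rewrite gi ler_nat.
  by case: leP => // /(lt_le_trans m1)/ltW ->.
Unshelve. all: by end_near. Qed.

End HaarSampling.

(** * Borel probabilities as means *)

Section BorelIntegral.
Context {R : realType}.

Lemma continuous_measurable_real (T : ptopologicalType) (f : T -> R) :
  continuous f -> measurable_fun [set: borel T] (f : borel T -> R).
Proof.
move=> cf; apply: (measurability _ (RGenOInfty.measurableE R)) => //.
move=> _ [_ [x ->] <-]; rewrite setTI; apply: sub_sigma_algebra.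
by apply: open_comp; [move=> t _; exact: cf|exact: interval_open].
Qed.

Lemma continuous_measurable_borel (T U : ptopologicalType) (f : T -> U) :
  continuous f -> measurable_fun [set: borel T] (f : borel T -> borel U).
Proof.
move=> cf; apply: (@measurability _ _ _ _ setT (f : borel T -> borel U) (@open U)) => //.
move=> _ [B oB <-]; rewrite setTI; apply: sub_sigma_algebra.
by apply: open_comp oB => t _; exact: cf.
Qed.

(** The source carries the product of the Borel sigma-algebras, not the Borel sigma-algebra of the
    product. [F] is a pointwise limit of finite sums of products of one-variable continuous
    functions. *)
Lemma continuous2_measurable (T B : ptopologicalType) (rho : T -> T -> R)
    (F : T * B -> R) : compact [set: T] -> compact [set: B] ->
  compatible_metric rho -> continuous F ->
  measurable_fun [set: borel T * borel B] (F : borel T * borel B -> R).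
Proof.
move=> cT cB rhoP cF; have [c1 c2] := continuous_section cF.
have app m : exists rl : seq T * (T -> T -> R),
    (forall c, continuous (rl.2 c)) /\
    forall a b, `|F (a, b) - \sum_(c <- rl.1) rl.2 c a * F (c, b)| <= m.+1%:R^-1.
  have m0 : 0 < m.+1%:R^-1 :> R by rewrite invr_gt0.
  have [eta eta0 hF] := uniform_close rhoP cB cF m0.
  have [r [lam hp]] := partition_of_unity_exists rhoP cT eta0.
  exists (r, lam); split; first exact: (pou_continuous hp).
  exact: tensor_approx hp hF.
have [rl hrl] := choice app.
apply: (@measurable_fun_cvg _ _ _ setT (fun m (z : borel T * borel B) =>
  \sum_(c <- (rl m).1) (rl m).2 c z.1 * F (c, z.2)) F).
- move=> m; apply: measurable_sum => c; apply: measurable_funM.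
    apply: (measurableT_comp (f := (rl m).2 c : borel T -> R)); last exact: measurable_fst.
    exact: continuous_measurable_real (proj1 (hrl m) c).
  apply: (measurableT_comp (f := (fun b => F (c, b)) : borel B -> R));
    last exact: measurable_snd.
  exact: continuous_measurable_real (c1 c).
- move=> [a b] _ /=; apply/cvgrPdist_le => e e0.
  near=> m; apply: (le_trans (proj2 (hrl m) a b)); apply: ltW.
  near: m; exact: (near_infty_natSinv_lt (PosNum e0)).
Unshelve. all: by end_near. Qed.

Lemma product_measure_setT d (O : measurableType d) (Q : probability O R) :
  (Q \x Q)%E setT = 1%E.
Proof.
rewrite -setXTT; apply: (etrans (product_measure1E _ _ _ _)) => //.
by rewrite -[RHS]mule1; congr (_ * _)%E; exact: probability_setT.
Qed.

Section ProbabilityMean.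
Context {T : ptopologicalType}.
Hypothesis cT : compact [set: T].
Variable m : Prob R T.

Lemma continuous_integrable (f : T -> R) : continuous f ->
  m.-integrable [set: borel T] (EFin \o (f : borel T -> R)).
Proof.
move=> cf; have [M M0 hM] := continuous_bounded cT cf.
apply: measurable_bounded_integrable => //.
- exact: fin_num_fun_lty.
- exact: continuous_measurable_real.
- exists M; split; first exact: gtr0_real.
  by move=> x Mx t _; apply: (le_trans (hM t)); exact: ltW.
Qed.

Lemma Rintegral_is_mean : is_mean (fun f : T -> R => \int[m]_x (f : borel T -> R) x).
Proof.
split.
- by move=> f g cf cg; apply: RintegralD => //; exact: continuous_integrable.
- by move=> a f cf; apply: RintegralZl => //; exact: continuous_integrable.
- by move=> f g cf cg fg; apply: le_Rintegral => //; exact: continuous_integrable.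
- rewrite Rintegral_cst // [X in fine X](_ : _ = 1%E) ?mulr1 //.
  exact: probability_setT.
Qed.

Lemma Rintegral_prod (rho : T -> T -> R) (F : T * T -> R) :
  compatible_metric rho -> continuous F ->
  \int[(m \x m)%E]_z (F : borel T * borel T -> R) z =
  \int[m]_(b in [set: borel T]) \int[m]_(a in [set: borel T]) F (a, b).
Proof.
move=> rhoP cF; have [c1 c2] := continuous_section cF.
have mF := continuous2_measurable cT cT rhoP cF.
have cTT : compact [set: T * T] by rewrite -setXTT; exact: compact_setX.
have [M M0 hM] := continuous_bounded cTT cF.
have iF : (m \x m)%E.-integrable setT (EFin \o (F : borel T * borel T -> R)).
  apply: measurable_bounded_integrable => //.
  - apply: (@le_lt_trans _ _ 1%E); last exact: ltry.
    by rewrite le_eqVlt; apply/orP; left; apply/eqP; exact: product_measure_setT.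
  - exists M; split; first exact: gtr0_real.
    by move=> x Mx t _; apply: (le_trans (hM t)); exact: ltW.
rewrite /Rintegral -(integral21_prod_meas1 iF); congr fine.
apply: eq_integral => b _; rewrite fineK //.
by apply: integrable_fin_num => //; exact: continuous_integrable.
Qed.

End ProbabilityMean.

(** A change of variables: [is_haar] says that translation pushes [m] forward to itself. *)
Lemma haar_left_invariant (Y : topologicalGroupType) (m : Prob R Y) :
  compact [set: Y] -> is_haar m ->
  left_invariant (fun f : Y -> R => \int[m]_x (f : borel Y -> R) x).
Proof.
move=> cY hm s f cf.
have cs : continuous (fun y : Y => (s * y)%g).
  by move=> y; apply: mulg_cvg; [exact: cvg_cst|exact: cvg_id].
have ms := continuous_measurable_borel cs.
have cfs := continuous_translate (s := s) cf.
rewrite /Rintegral; congr fine.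
transitivity (\int[pushforward m ((fun y => s * y)%g : borel Y -> borel Y)]_y (f y)%:E)%E.
  rewrite (integral_pushforward ms) //.
  - by apply/measurable_EFinP; exact: continuous_measurable_real.
  - exact: continuous_integrable.
by apply: eq_measure_integral => A mA _; exact: hm.
Qed.

End BorelIntegral.

(** * Rounding a measure to a finitely supported law *)

Section Discretization.
Context {R : realType}.

Lemma unif_avg n (A : set 'I_n) : unif R A = avg (fun j => (j \in A)%:R).
Proof.
rewrite /unif /avg mulrC -natr_sum -sum1_card big_mkcond /=.
by congr (_ * _%:R); apply: eq_bigr => j _; rewrite inE; case: (j \in A).
Qed.

Section Partition.
Context {dO : measure_display} {O : measurableType dO}.
Variable Q : {measure set O -> \bar R}.
Hypothesis Q1 : Q setT = 1%E.
Variables (I : finType) (code : O -> I).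
Hypothesis mcode : forall i, measurable (code @^-1` [set i]).

Let Qfin (B : set O) : measurable B -> Q B \is a fin_num.
Proof.
move=> mB; rewrite ge0_fin_numE //.
by apply: (@le_lt_trans _ _ (Q setT)); [apply: le_measure; rewrite ?inE|rewrite Q1 ltry].
Qed.

Lemma partition_measure (B : set O) : measurable B ->
  \sum_i fine (Q (code @^-1` [set i] `&` B)) = fine (Q B).
Proof.
move=> mB; have mi i : measurable (code @^-1` [set i] `&` B).
  by apply: measurableI => //; exact: mcode.
rewrite (_ : Q B = Q (\bigcup_(i in [set: I]) (code @^-1` [set i] `&` B))); last first.
  congr (Q _); apply/seteqP; split=> [x Bx|x [i _ []] //].
  by exists (code x).
rewrite measure_fin_bigcup //; first last.
- apply/trivIsetP => i j _ _ /eqP ij; rewrite -subset0 => x [[/= xi _] [/= xj _]].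
  by apply: ij; rewrite -xi -xj.
- exact: finite_finset.
rewrite (_ : [set: I] = [set` index_enum I]); last first.
  by apply/seteqP; split=> // i _ /=; rewrite mem_index_enum.
rewrite sum_fine; last by move=> i _; exact: Qfin.
by congr fine; exact: (@fsbig_seq _ _ _ _ (index_enum I) _ (index_enum_uniq I)).
Qed.

(** [v] is attached to cells, so one point of [Ev] in a cell bounds it there by [e]; cells that miss
    [Ev] lie in its complement and cost at most [M] times its mass. *)
Lemma partition_sum_le (v : I -> R) (Ev : set O) (e M : R) :
  measurable Ev -> 0 <= e -> 0 <= M -> (forall i, v i <= M) ->
  (forall x, Ev x -> v (code x) <= e) ->
  \sum_i fine (Q (code @^-1` [set i])) * v i <= e + M * (1 - fine (Q Ev)).
Proof.
move=> mE e0 M0 vM ve.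
have S1 : \sum_i fine (Q (code @^-1` [set i])) = 1.
  transitivity (fine (Q setT)); last exact: (congr1 fine Q1).
  rewrite -(partition_measure measurableT).
  by apply: eq_bigr => i _; rewrite setIT.
have mEC : measurable (~` Ev) by exact: measurableC.
have SC : fine (Q Ev) + fine (Q (~` Ev)) = 1.
  rewrite -fineD ?Qfin // -measureU //; last by rewrite setICr.
  by rewrite setUv; exact: (congr1 fine Q1).
have -> : 1 - fine (Q Ev) = fine (Q (~` Ev)) by rewrite -SC addrC addKr.
rewrite -[X in X + _]mulr1 -S1 -(partition_measure mEC) !mulr_sumr -big_split /=.
apply: ler_sum => i _.
have q0 : 0 <= fine (Q (code @^-1` [set i])) by exact: fine_ge0.
have q0' : 0 <= M * fine (Q (code @^-1` [set i] `&` ~` Ev)).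
  by rewrite mulr_ge0 // fine_ge0.
have [[x [xi Ex]]|hn] := pselect (exists x, code x = i /\ Ev x).
  rewrite mulrC; apply: (@le_trans _ _ (e * fine (Q (code @^-1` [set i])))).
    by apply: ler_wpM2r => //; rewrite -xi; exact: ve.
  by rewrite lerDl.
have -> : code @^-1` [set i] `&` ~` Ev = code @^-1` [set i].
  apply/seteqP; split=> [x []//|x xi]; split => // Ex.
  by apply: hn; exists x.
rewrite mulrC; apply: (@le_trans _ _ (M * fine (Q (code @^-1` [set i])))).
  exact: ler_wpM2r.
by rewrite lerDr mulr_ge0.
Qed.

End Partition.
End Discretization.

Section Rounding.
Context {R : realType} {T : ptopologicalType} {rho : T -> T -> R}.
Hypotheses (cT : compact [set: T]) (rhoP : compatible_metric rho).

Lemma open_borel_measurable (U : ptopologicalType) (A : set U) :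
  open A -> measurable (A : set (borel U)).
Proof. by move=> oA; apply: sub_sigma_algebra. Qed.

(** Rounding sends a point to the first centre within [tau]; the cell of a centre is its open ball
    minus the earlier balls. *)
Lemma measurable_find (s : seq T) (tau : R) (i : nat) :
  measurable ([set x | find (fun c => rho c x < tau) s = i] : set (borel T)).
Proof.
elim: s i => [|c s IH] i /=.
  have [->|i0] := eqVneq i 0%N.
    by rewrite (_ : mkset _ = setT) //; apply/seteqP; split.
  rewrite (_ : mkset _ = set0) //; apply/seteqP; split => // x /= h.
  by move: i0; rewrite -h eqxx.
have mc : measurable ([set x | rho c x < tau] : set (borel T)).
  exact: open_borel_measurable (open_cball rhoP c tau).
case: i => [|i].
  rewrite (_ : mkset _ = [set x | rho c x < tau]) //.
  by apply/seteqP; split => x /=; case: ifP.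
rewrite (_ : mkset _ = ~` [set x | rho c x < tau] `&`
    [set x | find (fun c => rho c x < tau) s = i]).
  by apply: measurableI; [exact: measurableC|exact: IH].
apply/seteqP; split => x /=; case: ifP => //.
- by move=> h [<-]; split => // h'; rewrite h' in h.
- by move=> h [].
- by move=> _ [_ ->].
Qed.

Lemma measurable_rounding (tau : R) : 0 < tau ->
  exists (N : nat) (r : 'I_N -> T) (code : borel T -> 'I_N),
    (forall i, measurable (code @^-1` [set i])) /\
    forall x, rho (r (code x)) x < tau.
Proof.
move=> tau0; have [s hs] := finite_net rhoP cT tau0.
have hfind x : (find (fun c => rho c x < tau)%R s < size s)%N.
  by rewrite -has_find; apply/hasP; have [c cs cx] := hs x; exists c.
exists (size s), (fun i => nth point s i), (fun x => Ordinal (hfind x)); split.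
  move=> i; rewrite (_ : _ @^-1` _ =
    [set x | find (fun c => rho c x < tau) s = i]); first exact: measurable_find.
  apply/seteqP; split => x /=; first by move=> <-.
  by move=> h; apply: val_inj.
by move=> x /=; apply: (@nth_find _ point (fun c => rho c x < tau)); rewrite has_find.
Qed.

Lemma measurable_coordinate_preimage n (j : 'I_n) (A : set (borel T)) :
  measurable A ->
  measurable ((fun phi : borel (power n T) => phi j) @^-1` A).
Proof.
by move=> mA; rewrite -[X in measurable X]setTI; exact: measurable_coordinate.
Qed.

(* Rounding [mu] to a law moves every sample by less than [tau] in each
   coordinate, so it preserves all events up to such a perturbation. *)
Lemma discretize n (mu : Prob R (power n T)) (tau : R) : 0 < tau ->
  exists s : seq (R * ('I_n -> T)), [/\ is_law s,
    forall (Ev : set (borel (power n T))) (F : ('I_n -> T) -> R) e M,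
      measurable Ev -> 0 <= e -> 0 <= M -> (forall phi, F phi <= M) ->
      (forall phi phi', (forall j, rho (phi' j) (phi j) < tau) -> Ev phi ->
        F phi' <= e) ->
      expect s F <= e + M * (1 - fine (mu Ev))
    & forall (Ev : set (borel (power n T) * borel (power n T)))
        (F : ('I_n -> T) -> ('I_n -> T) -> R) e M,
      measurable Ev -> 0 <= e -> 0 <= M -> (forall phi psi, F phi psi <= M) ->
      (forall phi phi' psi psi', (forall j, rho (phi' j) (phi j) < tau) ->
        (forall j, rho (psi' j) (psi j) < tau) -> Ev (phi, psi) ->
        F phi' psi' <= e) ->
      expect s (fun phi => expect s (F phi)) <=
        e + M * (1 - fine ((mu \x mu)%E Ev))].
Proof.
move=> tau0; have [N [r [code [mcode hcode]]]] := measurable_rounding tau0.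
pose I := {ffun 'I_n -> 'I_N}.
pose codes (phi : borel (power n T)) : I := [ffun j => code (phi j)].
pose pt (i : I) (j : 'I_n) : T := r (i j).
have mcodes i : measurable (codes @^-1` [set i]).
  rewrite (_ : _ @^-1` _ = \bigcap_(j in [set` index_enum 'I_n])
     ((fun phi : borel (power n T) => phi j) @^-1` (code @^-1` [set i j]))).
    apply: fin_bigcap_measurable; first exact: finite_finset.
    by move=> j _; apply: measurable_coordinate_preimage; exact: mcode.
  apply/seteqP; split => [phi <- j _ /=|phi h]; first by rewrite ffunE.
  by apply/ffunP => j; rewrite ffunE; apply: h; rewrite /= mem_index_enum.
pose wt i := fine (mu (codes @^-1` [set i])).
(* One atom per cell of the coordinatewise rounding, weighted by the mass of the cell; empty cells
   get weight [0]. *)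
pose s := [seq (wt i, pt i) | i <- index_enum I].
have sE F : expect s F = \sum_i wt i * F (pt i) by rewrite /expect big_map.
have mu1 : mu setT = 1%E by exact: probability_setT.
have close phi j : rho (pt (codes phi) j) (phi j) < tau.
  by rewrite /pt ffunE; exact: hcode.
exists s; split.
- split; first by rewrite all_map; apply/allP => i _; exact: fine_ge0.
  rewrite sE; under eq_bigr do rewrite mulr1.
  transitivity (fine (mu setT)); last exact: (congr1 fine mu1).
  rewrite -(partition_measure mu1 mcodes measurableT).
  by apply: eq_bigr => i _; rewrite setIT.
- move=> Ev F e M mE e0 M0 FM Fe; rewrite sE.
  apply: (partition_sum_le mu1 mcodes) => // phi Ephi.
  by apply: (Fe phi) => //; exact: close.
- move=> Ev F e M mE e0 M0 FM Fe; rewrite sE.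
  under eq_bigr do rewrite sE mulr_sumr.
  rewrite pair_bigA /=.
  (* The product law is the rounding of [mu \x mu] along pairs of codes: its cells are rectangles,
     whose masses multiply. *)
  pose codes2 (z : borel (power n T) * borel (power n T)) : I * I :=
    (codes z.1, codes z.2).
  have c2E p : codes2 @^-1` [set p] =
      (codes @^-1` [set p.1]) `*` (codes @^-1` [set p.2]).
    apply/seteqP; split => z /=; first by move=> <-.
    by case: p => p1 p2 /= [<- <-].
  have mcodes2 p : measurable (codes2 @^-1` [set p]).
    by rewrite c2E; apply: measurableX; exact: mcodes.
  have := partition_sum_le (product_measure_setT mu) mcodes2
    (v := fun p => F (pt p.1) (pt p.2)) mE e0 M0.
  move=> /(_ (fun p => FM _ _)); set S := \sum_i _ => hS.
  have -> : \sum_p wt p.1 * (wt p.2 * F (pt p.1) (pt p.2)) = S.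
    apply: eq_bigr => p _; rewrite mulrA /wt -fineM.
    + by congr (fine _ * _); rewrite c2E; apply/esym; exact: product_measure1E.
    + exact: fin_num_measure.
    + exact: fin_num_measure.
  apply: hS => -[phi psi] Ev'.
  by apply: (Fe phi _ psi) => // j; exact: close.
Qed.

End Rounding.

(** * From strongly sofic samples to concentrating, equivariant laws *)

Section FromStronglySofic.
Context {R : realType} {T : ptopologicalType} {rho : T -> T -> R}.
Hypotheses (cT : compact [set: T]) (rhoP : compatible_metric rho).

(* With [V] the mean of [theta(phi) a(phi)] for [theta] the signs, the left hand
   side is the square of [avg (V * w)] and the mean of [V ^+ 2] is a double
   expectation. *)
Lemma sqr_expect_avg_le n (s : seq (R * ('I_n -> T))) (a : T -> R) (w : 'I_n -> R) :
  is_law s -> (forall j, `|w j| <= 1) ->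
  expect s (fun phi => `|avg (fun j => a (phi j) * w j)|) ^+ 2 <=
  expect s (fun phi => expect s (fun psi => `|avg (fun j => a (phi j) * a (psi j))|)).
Proof.
move=> ls hw.
pose theta (phi : 'I_n -> T) : R := Num.sg (avg (fun j => a (phi j) * w j)).
have theta1 phi : `|theta phi| <= 1 by rewrite normr_sg lern1 leq_b1.
pose V j := expect s (fun phi => theta phi * a (phi j)).
have -> : expect s (fun phi => `|avg (fun j => a (phi j) * w j)|) =
    avg (fun j => V j * w j).
  transitivity (avg (fun j => expect s (fun phi => w j * (theta phi * a (phi j))))).
    rewrite (avg_expect s (fun phi j => w j * (theta phi * a (phi j)))).
    congr expect; apply/funext => phi.
    rewrite normrEsg -/(theta phi) -avgZ; congr avg; apply/funext => j; ring.
  by congr avg; apply/funext => j; rewrite expectZ mulrC.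
apply: (le_trans (sqr_avg_le _ hw)).
have -> : avg (fun j => V j ^+ 2) = expect s (fun phi => expect s (fun psi =>
    (theta phi * theta psi) * avg (fun j => a (phi j) * a (psi j)))).
  transitivity (avg (fun j => expect s (fun phi => expect s (fun psi =>
      (theta phi * theta psi) * (a (phi j) * a (psi j)))))); last first.
    rewrite (avg_expect s (fun phi j => expect s (fun psi =>
      (theta phi * theta psi) * (a (phi j) * a (psi j))))).
    congr expect; apply/funext => phi.
    rewrite (avg_expect s (fun psi j =>
      (theta phi * theta psi) * (a (phi j) * a (psi j)))).
    by congr expect; apply/funext => psi; exact: avgZ.
  congr avg; apply/funext => j.
  rewrite expr2 [X in X * _]/V mulrC -expectZ; congr expect; apply/funext => phi.
  rewrite [X in X * _]/V mulrC -expectZ; congr expect; apply/funext => psi; ring.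
apply: expect_le => // phi; apply: expect_le => // psi.
apply: le_trans (ler_norm _) _; rewrite normrM -[leRHS]mul1r.
apply: ler_wpM2r => //; rewrite normrM -[leRHS]mul1r; exact: ler_pM.
Qed.

Variables (d : nat -> nat) (G : groupType) (sigma : forall k, G -> 'S_(d k)).
Variables (m : Prob R T) (mu : forall k, Prob R (power (d k) T)).
Variable s : @random_maps R d T.
Hypothesis ls : forall k, is_law (s k).

Let mean f := \int[m]_x (f : borel T -> R) x.

Lemma measurable_avg_pair n (F : T * T -> R) : continuous F ->
  measurable_fun [set: borel (power n T) * borel (power n T)]
    (fun q : borel (power n T) * borel (power n T) => avg (fun j => F (q.1 j, q.2 j))).
Proof.
move=> cF; rewrite /avg; apply: measurable_funM; first exact: measurable_cst.
apply: measurable_sum => j.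
apply: (measurableT_comp (f := (F : borel T * borel T -> R))
  (g := fun q : borel (power n T) * borel (power n T) => (q.1 j : borel T, q.2 j : borel T))).
  exact: (continuous2_measurable cT cT rhoP).
apply/measurable_fun_pairP; split.
  by apply: (measurableT_comp (@measurable_coordinate n T j)); exact: measurable_fst.
by apply: (measurableT_comp (@measurable_coordinate n T j)); exact: measurable_snd.
Qed.

Lemma measurable_avg_near n (F : T * T -> R) (c e : R) : continuous F ->
  measurable [set q : borel (power n T) * borel (power n T) |
    `| avg (fun j => F (q.1 j, q.2 j)) - c | < e].
Proof.
move=> /(measurable_avg_pair (n := n)) mF.
have := measurable_funB mF (measurable_cst c).
move=> /(measurableT_comp (@normr_measurable R setT)) h.
rewrite -[X in measurable X]setTI.
exact: (h measurableT _ (measurable_itv `]-oo, e[)).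
Qed.

Hypothesis sE : forall k (Ev : set (borel (power (d k) T)))
    (F : ('I_(d k) -> T) -> R) e M,
  measurable Ev -> 0 <= e -> 0 <= M -> (forall phi, F phi <= M) ->
  (forall phi phi', (forall j, rho (phi' j) (phi j) < k.+1%:R^-1) -> Ev phi ->
    F phi' <= e) ->
  expect (s k) F <= e + M * (1 - fine (mu k Ev)).

Hypothesis sEE : forall k
    (Ev : set (borel (power (d k) T) * borel (power (d k) T)))
    (F : ('I_(d k) -> T) -> ('I_(d k) -> T) -> R) e M,
  measurable Ev -> 0 <= e -> 0 <= M -> (forall phi psi, F phi psi <= M) ->
  (forall phi phi' psi psi', (forall j, rho (phi' j) (phi j) < k.+1%:R^-1) ->
    (forall j, rho (psi' j) (psi j) < k.+1%:R^-1) -> Ev (phi, psi) ->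
    F phi' psi' <= e) ->
  expect (s k) (fun phi => expect (s k) (F phi)) <=
    e + M * (1 - fine ((mu k \x mu k)%E Ev)).

Lemma near_fine_measure (dO : nat -> measure_display)
    (O : forall k, measurableType (dO k)) (Q : forall k, set (O k) -> \bar R)
    (Ev : forall k, set (O k)) (M e : R) :
  Q k (Ev k) @[k --> \oo] --> 1%E -> 0 < e ->
  \forall k \near \oo, M * (1 - fine (Q k (Ev k))) <= e.
Proof.
move=> /fine_cvgP[_ /= h] e0.
have : M * (1 - fine (Q k (Ev k))) @[k --> \oo] --> M * (1 - 1).
  by apply: cvgM; [exact: cvg_cst|apply: cvgB; [exact: cvg_cst|exact: h]].
rewrite subrr mulr0 => /cvgrPdist_le /(_ e e0); apply: filterS => k.
by rewrite sub0r normrN => /(le_trans (ler_norm _)).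
Qed.

(** Double convergence is applied to [a x * a y] with [a] the centred [f], whose double integral is
    [0]. It bounds the square of the weighted mean, so the target is [e ^+ 2]. *)
Lemma discretization_concentrates :
  (forall (f : T * T -> R) (eps : R), continuous f -> 0 < eps ->
    (mu k \x mu k)%E [set q | `| (d k)%:R^-1 * \sum_(j < d k) f (q.1 j, q.2 j)
       - \int[(m \x m)%E]_z f z | < eps] @[k --> \oo] --> 1%E) ->
  concentrates s mean.
Proof.
move=> hmu f e cf e0.
have hM := Rintegral_is_mean cT m.
pose a x := f x - mean f.
have ca : continuous a.
  by move=> x; apply: cvgB; [exact: cf|exact: cvg_cst].
have [A A0 hA] := continuous_bounded cT ca.
pose F (z : T * T) := a z.1 * a z.2.
have cF : continuous F.
  by move=> z; apply: cvgM; apply: continuous_comp;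
    [exact: cvg_fst|exact: ca|exact: cvg_snd|exact: ca].
have ee : 0 < e ^+ 2 / 4 by rewrite divr_gt0 // exprn_gt0.
have iF : \int[(m \x m)%E]_z F z = 0.
  rewrite (Rintegral_prod cT m rhoP cF) /F /=.
  have ma : mean a = 0.
    have := meanD hM (f := f) (g := fun=> - mean f) cf.
    move=> h; rewrite /mean /a h; last by move=> x; exact: cvg_cst.
    by rewrite (mean_cst hM) subrr.
  transitivity (mean (fun=> 0)); last exact: (mean_cst hM).
  apply: eq_Rintegral => b _.
  transitivity (mean (fun x => a b * a x)).
    by apply: eq_Rintegral => x _; rewrite mulrC.
  by rewrite /mean (meanZ hM) // -/(mean a) ma mulr0.
pose Ev k : set (borel (power (d k) T) * borel (power (d k) T)) :=
  [set q | `| avg (fun j => F (q.1 j, q.2 j)) - 0 | < e ^+ 2 / 4].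
have hEv : (mu k \x mu k)%E (Ev k) @[k --> \oo] --> 1%E.
  by have := hmu F _ cF ee; rewrite iF.
have eA : 0 < e ^+ 2 / 4 / A by rewrite divr_gt0.
have ca' : continuous (fun q : T * T => a q.1).
  by move=> q; apply: continuous_comp; [exact: cvg_fst|exact: ca].
have [eta eta0 heta] := uniform_close rhoP cT ca' eA.
near=> k => w hw.
have h : expect (s k) (fun phi => expect (s k) (fun psi =>
    `|avg (fun j => a (phi j) * a (psi j))|)) <= e ^+ 2.
  (* One quarter of [e ^+ 2] comes from the event, one from rounding each of the two samples, and
     the last from the complement of the event. *)
  apply: (@le_trans _ _ (e ^+ 2 * 3 / 4 + A ^+ 2 *
      (1 - fine ((mu k \x mu k)%E (Ev k))))).
    apply: sEE.
    - exact: measurable_avg_near.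
    - by rewrite divr_ge0 // mulr_ge0 // exprn_ge0 // ltW.
    - exact: sqr_ge0.
    - move=> phi psi; apply: norm_avg_bound; first exact: sqr_ge0.
      by move=> j; rewrite normrM expr2; apply: ler_pM.
    move=> phi phi' psi psi' h1 h2; rewrite /Ev /= subr0 => hE.
    have keta : k.+1%:R^-1 < eta.
      by near: k; exact: (near_infty_natSinv_lt (PosNum eta0)).
    have -> : avg (fun j => a (phi' j) * a (psi' j)) =
        avg (fun j => F (phi j, psi j)) +
        avg (fun j => (a (phi' j) - a (phi j)) * a (psi' j)
                   + a (phi j) * (a (psi' j) - a (psi j))).
      by rewrite -avgD; congr avg; apply/funext => j; rewrite /F /=; ring.
    have -> : e ^+ 2 * 3 / 4 = e ^+ 2 / 4 + (e ^+ 2 / 4 + e ^+ 2 / 4) by field.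
    apply: (le_trans (ler_normD _ _)); apply: lerD; first exact: ltW.
    apply: norm_avg_bound => [|j]; first by rewrite addr_ge0 // ltW.
    have hd (x y : T) : rho x y < k.+1%:R^-1 -> `|a x - a y| <= e ^+ 2 / 4 / A.
      by move=> xy; apply: (heta x y (lt_trans xy keta) x).
    have eE : e ^+ 2 / 4 = e ^+ 2 / 4 / A * A by rewrite divfK // gt_eqF.
    apply: (le_trans (ler_normD _ _)); apply: lerD; rewrite normrM.
      by rewrite [leRHS]eE; apply: ler_pM => //; exact: hd.
    by rewrite [leRHS]eE mulrC; apply: ler_pM => //; exact: hd.
  have : A ^+ 2 * (1 - fine ((mu k \x mu k)%E (Ev k))) <= e ^+ 2 / 4.
    near: k; exact: (near_fine_measure (Q := fun k => (mu k \x mu k)%E)).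
  lra.
rewrite -ler_sqr ?nnegrE ?(ltW e0) //; last exact: expect_ge0.
exact: le_trans (sqr_expect_avg_le _ (ls k) hw) h.
Unshelve. all: by end_near. Qed.

Lemma measurable_unif_event n (p : 'S_n) (h : T -> T)
    (U : set (borel T * borel T)) (c : R) : continuous h -> measurable U ->
  measurable [set phi : borel (power n T) |
    c <= unif R [set j | U (phi (p j), h (phi j))]].
Proof.
move=> ch mU.
have mg j : measurable_fun [set: borel (power n T)]
    (fun phi : borel (power n T) => (phi (p j) : borel T, h (phi j) : borel T)).
  apply/measurable_fun_pairP; split; first exact: (@measurable_coordinate n T (p j)).
  apply: (measurableT_comp (f := (h : borel T -> borel T)));
    last exact: (@measurable_coordinate n T j).
  exact: continuous_measurable_borel.
have mf : measurable_fun [set: borel (power n T)] (fun phi : borel (power n T) =>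
    unif R [set j | U (phi (p j), h (phi j))]).
  have -> : (fun phi : borel (power n T) =>
      unif R [set j | U (phi (p j), h (phi j))]) =
      fun phi => avg (fun j => \1_U (phi (p j), h (phi j))).
    by apply/funext => phi; rewrite unif_avg; congr avg.
  rewrite /avg; apply: measurable_funM; first exact: measurable_cst.
  apply: measurable_sum => j.
  exact: (measurableT_comp (@measurable_indic _ _ R setT U mU) (mg j)).
rewrite -[X in measurable X]setTI.
have := mf measurableT _ (measurable_itv `[c, +oo[).
rewrite (_ : _ @^-1` _ = [set phi : borel (power n T) |
    c <= unif R [set j | U (phi (p j), h (phi j))]]) //.
by apply/seteqP; split => phi /=; rewrite in_itv /= andbT.
Qed.

Lemma measurable_cball2 (tau : R) :
  measurable ([set z | rho z.1 z.2 < tau] : set (borel T * borel T)).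
Proof.
have h := continuous2_measurable cT cT rhoP (cmetric_continuous rhoP).
rewrite -[X in measurable X]setTI.
exact: (h measurableT _ (measurable_itv `]-oo, tau[)).
Qed.

Lemma discretization_equivariant (act : G -> T -> T) :
  (forall g, continuous (act g)) ->
  (forall (g : G) (delta : R) (U : set (borel T * borel T)),
     0 < delta -> measurable U -> (forall x : T, nbhs (x, x) U) ->
     mu k [set phi | 1 - delta <= unif R [set j | U (phi (sigma k g j), act g (phi j))]]
       @[k --> \oo] --> 1%E) ->
  asymptotically_equivariant sigma rho act s.
Proof.
move=> ca hmu g eta e eta0 e0.
have e2 : 0 < e / 2 by rewrite divr_gt0.
have eta3 : 0 < eta / 3 by rewrite divr_gt0.
have [eta' eta'0 hca] := compatible_uniform_continuous cT rhoP rhoP (ca g) eta3.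
(* Thirds of [eta]: one for [U], one for rounding at [sigma k g j], one for [act g] applied to the
   rounding at [j]. *)
pose U : set (borel T * borel T) := [set z | rho z.1 z.2 < eta / 3].
have mU : measurable U by exact: measurable_cball2.
have nU (x : T) : nbhs (x, x) U.
  have := cmetric_continuous rhoP (x := (x, x)).
  move=> /cvgrPdist_lt /(_ _ eta3) /=; rewrite (cmetric_xx rhoP).
  apply: filterS => z; rewrite sub0r normrN => h.
  exact: le_lt_trans (ler_norm _) h.
have := hmu g (e / 2) U e2 mU nU.
pose Ev k : set (borel (power (d k) T)) :=
  [set phi | 1 - e / 2 <= unif R [set j | U (phi (sigma k g j), act g (phi j))]].
move=> hEv.
near=> k.
apply: (@le_trans _ _ (e / 2 + 1 * (1 - fine (mu k (Ev k))))).
  apply: sE => //.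
  - exact: measurable_unif_event.
  - exact: ltW.
  - move=> phi; apply: le_trans (avg_cst_le ler01); apply: avg_le => j.
    by rewrite -[leRHS]/(1%:R) ler_nat leq_b1.
  move=> phi phi' h1; rewrite /Ev /= unif_avg => h2.
  have k1 : k.+1%:R^-1 < eta / 3.
    by near: k; exact: (near_infty_natSinv_lt (PosNum eta3)).
  have k2 : k.+1%:R^-1 < eta'.
    by near: k; exact: (near_infty_natSinv_lt (PosNum eta'0)).
  apply: (@le_trans _ _ (1 - avg (fun j : 'I_(d k) =>
      (j \in [set j | U (phi (sigma k g j), act g (phi j))])%:R))); last lra.
  rewrite lerBrDr -avgD; apply: le_trans (avg_cst_le ler01).
  apply: avg_le => j; rewrite -natrD -[leRHS]/(1%:R) ler_nat.
  have [jU|_] := boolP (j \in _); last by rewrite addn0 leq_b1.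
  move: jU; rewrite inE /= /U /= => jU.
  suff -> : (eta <= rho (phi' (sigma k g j)) (act g (phi' j))) = false by [].
  apply/negbTE; rewrite -ltNge.
  have d1 := h1 (sigma k g j).
  have d2 : rho (act g (phi j)) (act g (phi' j)) < eta / 3.
    by apply: hca; rewrite (cmetric_sym rhoP); exact: lt_trans (h1 j) k2.
  have t1 := cmetric_triangle rhoP (phi (sigma k g j)) (phi' (sigma k g j)) (act g (phi' j)).
  have t2 := cmetric_triangle rhoP (act g (phi j)) (phi (sigma k g j)) (act g (phi' j)).
  move: (lt_trans d1 k1) => {}d1; lra.
have : 1 * (1 - fine (mu k (Ev k))) <= e / 2.
  near: k; exact: (near_fine_measure (Q := fun k => mu k)).
lra.
Unshelve. all: by end_near. Qed.

End FromStronglySofic.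

(** * Finitely supported laws as probability measures *)

Section LawMeasure.
Context {R : realType} {dO : measure_display} {O : measurableType dO}.
Implicit Type s : seq (R * O).

(** A weighted sum of Dirac masses. The formula for [m A] holds for every set [A], as Dirac masses
    are defined on all sets. *)
Lemma law_measure s : all (fun x => 0 <= x.1) s ->
  exists m : {measure set O -> \bar R},
    (forall A, m A = (expect s \1_A)%:E) /\
    (forall f : O -> R, measurable_fun setT (EFin \o f) -> (forall x, 0 <= f x) ->
      (\int[m]_x (f x)%:E = (expect s f)%:E)%E).
Proof.
elim: s => [_|[c x] s IH] /=.
  exists mzero; split=> [A|f mf f0]; first by rewrite /expect big_nil.
  by rewrite integral_measure_zero /expect big_nil.
move=> /andP[c0 /IH [m [mA mi]]].
exists (measure_add (mscale (NngNum c0) (\d_ x)) m); split=> [A|f mf f0].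
  apply: (etrans (measure_addE _ _ A)).
  by rewrite mA /expect big_cons EFinD EFinM.
rewrite ge0_integral_measure_add //; last by move=> y _; rewrite lee_fin.
rewrite mi // ge0_integral_mscale //; last by move=> y _; rewrite lee_fin.
by rewrite integral_dirac // diracT mul1e /expect big_cons EFinD EFinM.
Qed.

Lemma law_probability s : is_law s ->
  exists P : probability O R,
    (forall A, P A = (expect s \1_A)%:E) /\
    (forall f : O -> R, measurable_fun setT (EFin \o f) -> (forall x, 0 <= f x) ->
      (\int[P]_x (f x)%:E = (expect s f)%:E)%E).
Proof.
case=> s0 s1; have [m [mA mi]] := law_measure s0.
have mT : m setT = 1%E.
  by rewrite mA -s1; congr (expect s _)%:E; apply/funext => x; rewrite indicE mem_set.
(* Normalizing a measure of mass 1 changes no value but supplies the probability structure;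
   [\d_ point] is the fallback for mass [0] or infinity. *)
have pE A : mnormalize m (\d_ point) A = m A.
  by rewrite /mnormalize mT /= onee_eq0 /= invr1 mule1.
exists (mnormalize m (\d_ point)); split=> [A|f mf f0].
  by rewrite -mA; exact: pE.
by rewrite -mi //; apply: eq_measure_integral => A _ _; exact: pE.
Qed.

Lemma law_product s (P : probability O R) (A : set (O * O)) :
  (forall A, P A = (expect s \1_A)%:E) ->
  (forall f : O -> R, measurable_fun setT (EFin \o f) -> (forall x, 0 <= f x) ->
      (\int[P]_x (f x)%:E = (expect s f)%:E)%E) ->
  is_law s -> measurable A ->
  (P \x P)%E A = (expect s (fun x => expect s (fun y => \1_A (x, y))))%:E.
Proof.
move=> PA Pi ls mA.
have E x : P (xsection A x) = (expect s (fun y => \1_A (x, y)))%:E.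
  rewrite PA; congr (expect s _)%:E; apply/funext => y.
  by rewrite !indicE mem_xsection.
have mf := measurable_fun_xsection P mA.
rewrite -Pi.
- by rewrite /product_measure1; apply: eq_integral => x _ /=; exact: E.
- by apply: eq_measurable_fun mf => x _ /=; exact: E.
- by move=> x; apply: expect_ge0 => // y.
Qed.

End LawMeasure.

(** * From concentrating, equivariant laws back to strong soficity *)

Section ToStronglySofic.
Context {R : realType} {T : ptopologicalType} {rho : T -> T -> R}.
Hypotheses (cT : compact [set: T]) (rhoP : compatible_metric rho).
Variables (d : nat -> nat) (G : groupType) (sigma : forall k, G -> 'S_(d k)).
Hypothesis d_infty : d @ \oo --> \oo.
Variables (m : Prob R T) (s : @random_maps R d T).
Hypothesis ls : forall k, is_law (s k).

Let mean f := \int[m]_x (f : borel T -> R) x.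
Let hmean : is_mean mean := Rintegral_is_mean cT m.

Hypothesis cs : concentrates s mean.

Let d_gt0 : \forall k \near \oo, (0 < d k)%N.
Proof. by move/cvgnyPgt : d_infty => /(_ 0%N). Qed.

Variable mu : forall k, Prob R (power (d k) T).
Hypothesis muE : forall k A, mu k A = (expect (s k) \1_A)%:E.
Hypothesis mu_integral : forall k (f : borel (power (d k) T) -> R),
  measurable_fun setT (EFin \o f) -> (forall x, 0 <= f x) ->
  (\int[mu k]_x (f x)%:E = (expect (s k) f)%:E)%E.

Lemma marginal_integral k (j : 'I_(d k)) (f : T -> R) : continuous f ->
  \int[marginal (mu k) j]_x (f : borel T -> R) x =
  expect (s k) (fun phi => f (phi j)).
Proof.
move=> cf; have [M M0 hM] := continuous_bounded cT cf.
have hL := Rintegral_is_mean cT (marginal (mu k) j).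
have cM : continuous (fun _ : T => M) by move=> x; exact: cvg_cst.
have cfM : continuous (fun x => f x + M).
  by move=> x; apply: cvgD; [exact: cf|exact: cM].
have fM0 x : 0 <= f x + M by have := hM x; rewrite ler_norml => /andP[]; lra.
(* Adding the bound [M] makes the integrand nonnegative, as the change of variables and
   [mu_integral] require. *)
apply: (addIr M); have := meanD hL cf cM; rewrite (mean_cst hL M) => <-.
rewrite -[X in _ = _ + X](expect_cst M (ls k)) -expectD.
have mfM := continuous_measurable_real cfM.
rewrite /Rintegral /marginal /distribution ge0_integral_pushforward //.
- rewrite preimage_setT mu_integral //; apply/measurable_EFinP.
  exact: (measurableT_comp mfM (@measurable_coordinate (d k) T j)).
- exact/measurable_EFinP.
- by move=> x _; rewrite lee_fin.
Qed.

Lemma marginals_cvg (O : set (weak_star R T)) : nbhs (m : weak_star R T) O ->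
  unif R [set j | O (marginal (mu k) j)] @[k --> \oo] --> (1 : R).
Proof.
move=> nO.
(* The sets containing all marginals up to an asymptotically vanishing proportion of indices. They
   form a filter, so weak* convergence can be checked on one test function at a time. *)
pose Phi : set_system (Prob R T) := fun A => forall e : R, 0 < e ->
  \forall k \near \oo, avg (fun j => (~~ `[< A (marginal (mu k) j) >])%:R) <= e.
have FPhi : Filter Phi.
  split.
  - move=> e e0; near=> k.
    rewrite (_ : (fun _ => _) = (fun=> 0)); last first.
      by apply/funext => j; rewrite asboolT.
    by apply: le_trans (avg_cst_le (lexx 0)) _; exact: ltW.
  - move=> A B hA hB e e0; have e2 : 0 < e / 2 by rewrite divr_gt0.
    apply: filterS2 (hA _ e2) (hB _ e2) => k h1 h2.
    rewrite [leRHS]splitr; apply: le_trans (lerD h1 h2); rewrite -avgD.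
    apply: avg_le => j; rewrite -natrD ler_nat asbool_and negb_and.
    by case: asboolP; case: asboolP.
  - move=> A B AB hA e e0; apply: filterS (hA e e0) => k; apply: le_trans.
    apply: avg_le => j; rewrite ler_nat.
    case: asboolP => // hB; case: asboolP => // hA'.
    by case: hB; exact: AB.
have cvgPhi : (@integration R T) @ Phi -->
    (integration m : {ptws continuousType T R -> R}).
  apply/cvg_sup => f A [_ [[C oC <-] Cf] CA].
  suff h : Phi [set nu | C (integration nu f)].
    by apply: (filterS (F := Phi) _ h) => nu; exact: (CA (integration nu)).
  have : nbhs (integration m f) C by exact: open_nbhs_nbhs.
  rewrite -nbhs_ballE => -[e /= e0 eC].
  suff h : Phi [set nu | `|integration m f - integration nu f| < e].
    by apply: (filterS (F := Phi) _ h) => nu; exact: (eC (integration nu f)).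
  have cf : continuous (f : T -> R) by exact: cts_fun.
  move=> e' e'0; have ee : 0 < e * e' by rewrite mulr_gt0.
  have := cs cf ee; apply: filterS => k hk.
  (* [V j] is the bias of the [j]-th marginal on [f]. Its signs, used as weights, turn the average
     of [|V|] into a weighted sample average; Markov then bounds the proportion of indices with bias
     at least [e]. *)
  pose V j := expect (s k) (fun phi => f (phi j) - mean f).
  pose w j := Num.sg (V j).
  have w1 j : `|w j| <= 1 by rewrite normr_sg lern1 leq_b1.
  have VE j : mean f - \int[marginal (mu k) j]_x (f : borel T -> R) x = - V j.
    by rewrite marginal_integral // /V expectD (expect_cst _ (ls k)) opprD opprK addrC.
  have key : avg (fun j => `|V j|) <= e * e'.
    apply: le_trans (hk w w1).
    have -> : avg (fun j => `|V j|) =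
        expect (s k) (fun phi => avg (fun j => (f (phi j) - mean f) * w j)).
      rewrite -(avg_expect (s k) (fun phi j => (f (phi j) - mean f) * w j)).
      congr avg; apply/funext => j; rewrite normrEsg -/(w j) -expectZ.
      by congr expect; apply/funext => phi; rewrite mulrC.
    by apply: expect_le => // phi; exact: ler_norm.
  rewrite -(ler_pM2l e0); apply: le_trans key; rewrite -avgZ; apply: avg_le => j.
  case: asboolP => [_|/negP]; first by rewrite mulr0.
  by rewrite mulr1 -leNgt [X in `|X|]VE normrN.
have PhiO : Phi O.
  move: nO => [_ [[B oB <-] Bm] BO].
  apply: (filterS (F := Phi) BO).
  have : nbhs (integration m : {ptws continuousType T R -> R}) B.
    exact: open_nbhs_nbhs.
  exact: cvgPhi.
apply/cvgrPdist_le => e e0; near=> k.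
(* For [d k = 0] every proportion would be [0]; [d_infty] excludes this for large [k]. *)
have dk : (0 < d k)%N by near: k; exact: d_gt0.
rewrite -[X in X - _](avg_cst 1 dk) unif_avg -mulN1r -avgZ -avgD.
rewrite ger0_norm; last first.
  by apply: avg_ge0 => j; rewrite mulN1r subr_ge0 -[leRHS]/(1%:R) ler_nat leq_b1.
apply: (@le_trans _ _ (avg (fun j => (~~ `[< O (marginal (mu k) j) >])%:R))).
  apply: avg_le => j; rewrite mulN1r.
  case: asboolP => h; first by rewrite mem_set // subrr.
  by rewrite memNset // subr0.
by near: k; exact: PhiO.
Unshelve. all: by end_near. Qed.

(** Markov's inequality, phrased for the good event [A], because strong soficity asks for
    probabilities tending to 1. *)
Lemma law_markov (Om : Type) (u : seq (R * Om)) (A : set Om) (F : Om -> R) (c e : R) :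
  is_law u -> 0 < c -> (forall x, 0 <= F x) -> (forall x, ~ A x -> c <= F x) ->
  expect u F <= c * e -> `|1 - expect u \1_A| <= e.
Proof.
move=> lu c0 F0 cF hF.
have -> : 1 - expect u \1_A = expect u (fun x => 1 - \1_A x).
  by rewrite expectD (expect_cst _ lu) -mulN1r -expectZ;
    congr (_ + expect _ _); apply/funext => x; rewrite mulN1r.
rewrite ger0_norm; last first.
  by apply: expect_ge0 => // x; rewrite indicE subr_ge0 -[leRHS]/(1%:R) ler_nat leq_b1.
rewrite -(ler_pM2l c0); apply: le_trans hF; rewrite -expectZ; apply: expect_le => // x.
rewrite indicE; have [xA|xA] := pselect (A x); first by rewrite mem_set // subrr mulr0.
by rewrite memNset // subr0 mulr1; exact: cF.
Qed.

Lemma equivariance_cvg (act : G -> T -> T) (g : G) (delta : R)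
    (U : set (borel T * borel T)) :
  asymptotically_equivariant sigma rho act s ->
  0 < delta -> (forall x : T, nbhs (x, x) U) ->
  mu k [set phi | 1 - delta <= unif R [set j | U (phi (sigma k g j), act g (phi j))]]
    @[k --> \oo] --> 1%E.
Proof.
move=> es delta0 nU.
have [eta eta0 hU] := cmetric_diagonal rhoP nU.
under eq_cvg do rewrite muE.
apply: cvg_EFin; first by near=> k.
apply/cvgrPdist_le => e e0 /=.
have de : 0 < delta * e by rewrite mulr_gt0.
near=> k; have dk : (0 < d k)%N by near: k; exact: d_gt0.
apply: (law_markov (F := fun phi => avg (fun j =>
  (eta <= rho (phi (sigma k g j)) (act g (phi j)))%R%:R)) (ls k) delta0).
- by move=> phi; apply: avg_ge0 => j.
- move=> phi /negP; rewrite -ltNge unif_avg => h.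
  have : avg (fun j => 1 - (eta <= rho (phi (sigma k g j)) (act g (phi j)))%R%:R) <=
      avg (fun j : 'I_(d k) =>
        (j \in [set j | U (phi (sigma k g j), act g (phi j))])%:R) :> R.
    apply: avg_le => j.
    have [_|hj] := leP eta (rho (phi (sigma k g j)) _); first by rewrite subrr.
    by rewrite mulr0n subr0 mem_set //; exact: hU hj.
  have -> : avg (fun j : 'I_(d k) =>
      1 - (eta <= rho (phi (sigma k g j)) (act g (phi j)))%R%:R : R) =
      1 - avg (fun j => (eta <= rho (phi (sigma k g j)) (act g (phi j)))%R%:R).
    rewrite avgD avg_cst // -[X in _ = _ + X]mulN1r -avgZ; congr (_ + avg _).
    by apply/funext => j; rewrite mulN1r.
  lra.
- by near: k; exact: es.
Unshelve. all: by end_near. Qed.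

(** [concentrates_tensor] pairs [s] with itself; the constant weight 1 and Markov under the product
    law then give the convergence in probability. *)
Lemma double_cvg (f : T * T -> R) (eps : R) : continuous f -> 0 < eps ->
  (mu k \x mu k)%E [set q | `| (d k)%:R^-1 * \sum_(j < d k) f (q.1 j, q.2 j)
     - \int[(m \x m)%E]_z f z | < eps] @[k --> \oo] --> 1%E.
Proof.
move=> cf eps0; rewrite (Rintegral_prod cT m rhoP cf).
set I := Rintegral _ _ _.
pose Ev k : set (borel (power (d k) T) * borel (power (d k) T)) :=
  [set q | `| avg (fun j => f (q.1 j, q.2 j)) - I | < eps].
have hE k : (mu k \x mu k)%E (Ev k) =
    (expect (s k) (fun x => expect (s k) (fun y => \1_(Ev k) (x, y))))%:E.
  apply: (law_product (@muE k) (@mu_integral k) (ls k)).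
  exact: (measurable_avg_near cT rhoP).
suff : (fun k => (mu k \x mu k)%E (Ev k)) @ \oo --> 1%E by [].
rewrite (funext hE).
apply: cvg_EFin; first by near=> k.
apply/cvgrPdist_le => e e0 /=.
have ee : 0 < eps * e by rewrite mulr_gt0.
near=> k; have dk : (0 < d k)%N by near: k; exact: d_gt0.
rewrite -(expect_prod (s k) (s k) \1_(Ev k)).
apply: (law_markov (F := fun q => `|avg (fun j => f (q.1 j, q.2 j)) - I|)
  (is_law_prod (ls k) (ls k)) eps0) => //.
- by move=> q /negP; rewrite -leNgt.
rewrite expect_prod /=.
have h : forall w : 'I_(d k) -> R, (forall j, `|w j| <= 1) ->
    expect (s k) (fun a => expect (s k) (fun b =>
      `|avg (fun j => (f (a j, b j) - I) * w j)|)) <= eps * e.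
  near: k.
  exact: (concentrates_tensor rhoP cT cT hmean hmean ls ls cs cs cf ee).
apply: le_trans (h (fun=> 1) _); last by move=> j; rewrite normr1.
apply: expect_le => // a; apply: expect_le => // b.
rewrite -[X in `|_ - X|](avg_cst I dk) -mulN1r -avgZ -avgD le_eqVlt; apply/orP; left.
by apply/eqP; congr (`|avg _|); apply/funext => j; rewrite mulr1 mulN1r.
Unshelve. all: by end_near. Qed.

End ToStronglySofic.

(** * Transfer of strong soficity along the factor map *)

Theorem theorem1p4 (R : realType) (G : groupType) (d : nat -> nat)
    (sigma : forall k : nat, G -> 'S_(d k))
    (X Y : topologicalGroupType) (actX : G -> X -> X) (actY : G -> Y -> Y)
    (mX : Prob R X) (mY : Prob R Y) :
  countable [set: G] ->
  sofic_approximation R sigma ->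
  algebraic_action R actX ->
  algebraic_action R actY ->
  is_haar mX ->
  is_haar mY ->
  ergodic actX mX ->
  ergodic actY mY ->
  topological_factor actX actY ->
  strongly_sofic actX mX sigma ->
  strongly_sofic actY mY sigma.
Proof.
move=> cG [d_infty _ _] [cX /(metrizable_compatible cX)[rhoX rX] _ cactX _]
  [cY /(metrizable_compatible cY)[rhoY rY] _ _ actYM] haarX haarY _ _
  [p [cp ep sp]] [mu [_ mu2 mu3]].
pose meanX f := \int[mX]_x (f : borel X -> R) x.
have hmeanX : is_mean meanX := Rintegral_is_mean cX mX.
have hmeanY := Rintegral_is_mean cY mY.
have tau0 k : 0 < k.+1%:R^-1 :> R by rewrite invr_gt0.
(* The scale [1/(k+1)] tends to [0], hence is eventually below every modulus of continuity. *)
have hs k := discretize cX rX (mu k) (tau0 k).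
pose s k := projT1 (cid (hs k)).
have ls k : is_law (s k) by rewrite /s; case: cid => u [].
have cs : concentrates s meanX.
  apply: (discretization_concentrates cX rX ls _ mu3) => k.
  by rewrite /s; case: cid => u [].
have es : asymptotically_equivariant sigma rhoX actX s.
  apply: (discretization_equivariant cX rX _ cactX mu2) => k.
  by rewrite /s; case: cid => u [].
(* The image of the Haar mean of [X] under [p]. Surjectivity of [p] and full support of Haar measure
   make it strictly positive. *)
pose L f := meanX (f \o p).
have cfp (f : Y -> R) : continuous f -> continuous (f \o p).
  by move=> cf x; apply: continuous_comp; [exact: cp|exact: cf].
have hL : is_mean L.
  split.
  - by move=> f g cf cg; apply: (meanD hmeanX); exact: cfp.
  - by move=> a f cf; apply: (meanZ hmeanX); exact: cfp.
  - by move=> f g cf cg fg; apply: (mean_le hmeanX) => [||x]; [exact: cfp|exact: cfp|exact: fg].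
  - exact: (mean1 hmeanX).
have Lpos : strictly_positive L.
  move=> f cf f0 [y fy].
  apply: (invariant_strictly_positive cX hmeanX (haar_left_invariant cX haarX)).
  - exact: cfp.
  - by move=> x; exact: f0.
  - by have [x _ xy] := sp y I; exists x; rewrite /= xy.
have [t [lt ct et]] := haar_sampling cY rY cG actYM hL Lpos hmeanY
  (haar_left_invariant cY haarY) (fun k => is_law_map (fun phi : 'I_(d k) -> X => p \o phi) (ls k))
  (concentrates_push cp cs)
  (asymptotically_equivariant_push cX rX rY cp ep ls es).
pose hP k := cid (law_probability (O := borel (power (d k) Y)) (lt k)).
exists (fun k => projT1 (hP k)).
have PE k A : projT1 (hP k) A = (expect (t k) \1_A)%:E.
  exact: (projT2 (hP k)).1.
have Pi k (f : borel (power (d k) Y) -> R) :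
    measurable_fun setT (EFin \o f) -> (forall x, 0 <= f x) ->
    (\int[projT1 (hP k)]_x (f x)%:E = (expect (t k) f)%:E)%E.
  exact: (projT2 (hP k)).2.
split.
- move=> O nO; exact: (marginals_cvg cY d_infty lt ct Pi nO).
- move=> g delta U delta0 _ nU.
  exact: (equivariance_cvg rY d_infty lt PE g et delta0 nU).
- move=> f eps cf eps0.
  exact: (double_cvg cY rY d_infty lt ct PE Pi cf eps0).
Qed.
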